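(* Let $1\le p<q<\infty$, $r_0>0$, $\alpha>0$ and $\lambda\ge1$. Assume that there are constants $C,\delta>0$ such that for all $x\in E$ and $0<r'<r\le r_0$, $$0<\mu(B(x,2r))\le C\mu(B(x,r))<\infty,\quad 0<\nu(B(x,2r))\le C\nu(B(x,r))<\infty,\quad\frac{\nu(B(x,r'))}{\nu(B(x,r))}\le C\Bigl(\frac{r'}r\Bigr)^\delta .$$ Let $u\in L^1_{\rm loc}(X,\mu)$ be such that $$u(x)=\lim_{r\to0}\frac1{\mu(B(x,r))}\int_{B(x,r)}u\,d\mu\quad\text{for $\nu$-a.e. }x\in E$$ and, for some function $0\le g\in L^p_{\rm loc}(X,\mu)$, the $p$-Poincar\'e inequality $$\frac1{\mu(B)}\int_B|u-u_{B,\mu}|\,d\mu\le C[\operatorname{diam}(B)]^\alpha\biggl(\frac1{\mu(\lambda B)}\int_{\lambda B}g^p\,d\mu\biggr)^{1/p}\qquad( * )$$ holds on all balls $B$ centred in $E$ and with radius at most $r_0$. Assume that $$\Theta_{q,\lambda}(r):=\sup_{0<\rho\le r}\ \sup_{x\in E}\frac{\rho^\alpha\,\nu(B(x,\rho))^{1/q}}{\mu(B(x,\lambda\rho))^{1/p}},\quad0<r\le r_0,$$ satisfies $\Theta_{q,\lambda}(r_0)<\infty$. Then the following are true with $C_{q,\lambda}>0$ depending only on $p,q,\mu,\nu,\alpha,\lambda$ and $\delta$, but not on $x,r,u$ and $g$: (i) For all $1\le q'<q$, the two-weighted Poincar\'e type inequality $$\biggl(\int_{B\cap E}|u-u_{B,\mu}|^{q'}\,d\nu\biggr)^{1/q'}\le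 C_{q,\lambda}\,\Theta_{q,\lambda}(r)\,\frac{\nu(B\cap E)^{1/q'-1/q}}{q-q'}\biggl(\int_{2\lambda B}g^p\,d\mu\biggr)^{1/p}$$ holds for all balls $B=B(x,r)$ with $x\in E$ and $10\lambda r\le r_0$. In particular, $u\in L^{q'}_{\rm loc}(E,\nu)$. (ii) If the pair $(u,g)$ also satisfies the truncation property, i.e. for all $l<k$ the inequality $( * )$ holds with $u$ and $g$ replaced by $u_{l,k}:=\max\{l,\min\{u,k\}\}$ and $g_{l,k}:=g\chi_{\{l<u<k\}}$, respectively, then the inequality in (i) holds also for $q'=q$, i.e. $$\biggl(\int_{B\cap E}|u-u_{B,\mu}|^{q}\,d\nu\biggr)^{1/q}\le C_{q,\lambda}\,\Theta_{q,\lambda}(r)\biggl(\int_{2\lambda B}g^p\,d\mu\biggr)^{1/p}$$ for all balls $B=B(x,r)$ with $x\in E$ and $10\lambda r\le r_0$.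
   Context: $(X,d)$ is a metric space with positive complete Borel measures $\mu,\nu$, and $E\subset X$ is $\nu$-measurable with $\nu(E)>0$. $B(x,r)$ is the open ball; balls come with a predetermined centre and radius; $\lambda B(x,r)=B(x,\lambda r)$; $u_{B,\mu}=\mu(B)^{-1}\int_Bu\,d\mu$. $u\in L^p_{\rm loc}(X,\mu)$ means $u\in L^p(B,\mu)$ for all balls $B\subset X$, and $L^{q'}_{\rm loc}(E,\nu)$ is understood in the same way, with $E$ and $\nu$ in place of $X$ and $\mu$. The letter $C$ denotes positive constants which may differ at each occurrence; the constant in $( * )$ does not depend on $B$. In the truncation property, the constants in $( * )$ for the truncated pairs are the same for all $l<k$, and $( * )$ is required for all balls centred in $E$ with radius at most $r_0$.
   Formalization: ''In particular, u∈L^{q'}_loc(E,ν)'' is false for all balls (infinitely many far-apart weighted intervals inside one ball); it is proved for balls B centred in E with B∩E covered by finitely many balls of radius r0/(10λ) centred in E. C_{q,λ} also depends on the constants C in the hypotheses. *)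

(* Defs.v *)
From HB Require Import structures.
From mathcomp Require Import all_boot all_order all_algebra.
From mathcomp Require Import all_classical all_reals all_analysis.
From mathcomp Require Import measurable_realfun.

Set Implicit Arguments.
Unset Strict Implicit.
Unset Printing Implicit Defensive.

Import Order.TTheory GRing.Theory Num.Theory.
Import numFieldNormedType.Exports.

Local Open Scope classical_set_scope.
Local Open Scope ring_scope.
Local Open Scope ereal_scope.

(* A metric space with a base point: measurable types are pointed in this
   library, so this amounts to X being nonempty. *)
#[short(type="pmetricType")]
HB.structure Definition PointedMetric (K : numDomainType) :=
  { M of Metric K M & Pointed M }.

(* Functions are extended-real-valued.  At infinite or vanishing measures the
   ereal conventions are (+oo)^-1 = 0, 0^-1 = +oo and 0 * +oo = 0. *)

Definition mean {d} {T : measurableType d} {R : realType}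
    (mu : {measure set T -> \bar R}) (B : set T) (f : T -> \bar R) : \bar R :=
  (mu B)^-1 * \int[mu]_(y in B) f y.

Definition Lp_on {d} {T : measurableType d} {R : realType}
    (mu : {measure set T -> \bar R}) (p : R) (A : set T) (f : T -> \bar R) :
    Prop :=
  measurable_fun A f /\ \int[mu]_(x in A) (`|f x| `^ p) < +oo.

(* Two measures on the same metric space may live on different (complete)
   sigma-algebras.  Each is therefore a measure on the measurable space
   g_sigma_algebraType G, whose carrier is X and whose sigma-algebra is <<s G>>;
   an arbitrary sigma-algebra S is obtained by taking G := S. *)
Section metric_measure.
Context {R : realType} {X : pmetricType R}.
Implicit Types (G : set (set X)) (E : set X) (u g : X -> \bar R).
Implicit Types (p q alpha lam r : R).

Definition complete_Borel G (mu : {measure set (g_sigma_algebraType G) -> \bar R})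
    : Prop :=
  (forall A : set X, open A -> measurable (A : set (g_sigma_algebraType G)))
  /\ measure_is_complete mu.

Definition diam (A : set X) : \bar R :=
  ereal_sup [set (mdist z.1 z.2)%:E | z in A `*` A].

Definition Lploc G (mu : {measure set (g_sigma_algebraType G) -> \bar R}) p u :
    Prop :=
  forall (x : X) (r : R), (0 < r)%R -> Lp_on mu p (ball x r) u.

(* Membership in L^p(B `&` E) for the balls B centred in E, of any radius, for
   which B `&` E is covered by finitely many balls of radius rho centred in E;
   balls of radius at most rho qualify trivially, and all balls do when the balls
   of E are totally bounded.  Some such restriction is unavoidable for conclusions
   drawn from estimates on small balls only: on the disjoint union of copies X_n
   of [0, 1] at mutual distance 1, with mu = w_n dx and nu = w_n^q dx on X_n,
   functions constant on each X_n (with g = 0 and p = alpha = 1) can be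
   mu-integrable on X, which is a ball, without being in L^q'(X, nu). *)
Definition Lploc_in G (nu : {measure set (g_sigma_algebraType G) -> \bar R})
    p E (rho : R) u : Prop :=
  forall (x : X) (r : R), E x -> (0 < r)%R ->
  (exists F : set X, [/\ finite_set F, F `<=` E &
     ball x r `&` E `<=` \bigcup_(y in F) ball y rho]) ->
  Lp_on nu p (ball x r `&` E) u.

Definition doubling_on G (mu : {measure set (g_sigma_algebraType G) -> \bar R})
    E (r0 C : R) : Prop :=
  forall (x : X) (r : R), E x -> (0 < r <= r0)%R ->
  [/\ 0 < mu (ball x (2 * r)), mu (ball x (2 * r)) <= C%:E * mu (ball x r)
    & C%:E * mu (ball x r) < +oo].

Definition reverse_doubling_on G
    (nu : {measure set (g_sigma_algebraType G) -> \bar R})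
    E (r0 C delta : R) : Prop :=
  forall (x : X) (r' r : R), E x -> (0 < r')%R -> (r' < r)%R -> (r <= r0)%R ->
  nu (ball x r') / nu (ball x r) <= (C * (r' / r) `^ delta)%:E.

Definition Lebesgue_values G
    (mu : {measure set (g_sigma_algebraType G) -> \bar R}) u (x : X) : Prop :=
  mean mu (ball x r) u @[r --> (0:R)^'+] --> u x.

Definition Poincare G (mu : {measure set (g_sigma_algebraType G) -> \bar R})
    E (r0 alpha p lam C : R) u g : Prop :=
  forall (x : X) (r : R), E x -> (0 < r <= r0)%R ->
  mean mu (ball x r) (fun y => `|u y - mean mu (ball x r) u|) <=
  C%:E * diam (ball x r) `^ alpha
       * (mean mu (ball x (lam * r)) (fun y => g y `^ p)) `^ p^-1.

Definition trunc u (l k : R) : X -> \bar R :=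
  fun x => maxe l%:E (mine (u x) k%:E).

Definition trunc_grad u g (l k : R) : X -> \bar R :=
  fun x => g x * (\1_[set y | (l%:E < u y < k%:E)%E] x)%:E.

Definition truncation_property G
    (mu : {measure set (g_sigma_algebraType G) -> \bar R})
    E (r0 alpha p lam C : R) u g : Prop :=
  forall l k : R, (l < k)%R ->
  Poincare mu E r0 alpha p lam C (trunc u l k) (trunc_grad u g l k).

Definition Theta Gmu Gnu
    (mu : {measure set (g_sigma_algebraType Gmu) -> \bar R})
    (nu : {measure set (g_sigma_algebraType Gnu) -> \bar R})
    E (alpha p q lam r : R) : \bar R :=
  ereal_sup [set ereal_sup
    [set (rho `^ alpha)%:E * nu (ball x rho) `^ q^-1
           / mu (ball x (lam * rho)) `^ p^-1 | x in E]
    | rho in [set rho : R | (0 < rho <= r)%R]].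

End metric_measure.

(* Main.v *)
Require Import Defs.
From HB Require Import structures.
From mathcomp Require Import all_boot all_order all_algebra.
From mathcomp Require Import all_classical all_reals all_analysis.
From mathcomp Require Import measurable_realfun.
From mathcomp Require Import ring lra.

(* At a Lebesgue point x of B, u(x) - u_B telescopes along the balls
   B_i = B(x, r / 2^i), the first step passing through 2B because
   lam (2B) = 2 lam B.  By the Poincare inequality and the definition of Theta
   the i-th term is at most a constant times
     Theta(r) nu(B_i)^(-1/q) (int_{lam B_i} g^p dmu)^(1/p).
   Where int_{lam B_i} g^p dmu <= s nu(B_i) for all i, Hedberg's splitting of this
   sum, together with the geometric decay of nu(B_i), bounds |u(x) - u_B| by
   C Theta(r) (int_{2 lam B} g^p dmu)^(1/p - 1/q) s^(1/q); a Vitali covering bounds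
   the nu-measure of the other points by C / s int_{2 lam B} g^p dmu.  The choice of
   s gives a weak type (p, q) estimate.  Summing it over dyadic levels of |u - u_B|
   yields the case q' < q.  For q' = q, Maz'ya's truncation applies it to the
   truncations of u between consecutive levels: the integrals of g^p over the
   disjoint sets {l < u < k} add up, and q >= p. *)

Set Implicit Arguments.
Unset Strict Implicit.
Unset Printing Implicit Defensive.

Import Order.TTheory GRing.Theory Num.Theory.
Import numFieldNormedType.Exports.

Local Open Scope classical_set_scope.
Local Open Scope ring_scope.
Local Open Scope ereal_scope.

(** * Sums along geometrically decaying sequences *)

Section real_sums.
Local Open Scope ring_scope.
Context {R : realType}.
Implicit Types (a b c s x y G th : R) (sg : nat -> R).

(** [mu] and [nu] may live on different sigma-algebras, so neither [u] nor the set where the maximal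
    function is large is known to be [nu]-measurable. The function is recovered as an almost
    everywhere limit of its means over balls; the bad set is only ever enclosed in a measurable set
    [W] of small measure. The chain and the weak type estimate are stated for every [admissible]
    pair, with convergence of means required along the radii r / 2^i alone. Truncated pairs inherit
    these conditions, the convergence at almost every point, which is what lets the case q' = q
    reuse the weak type estimate. The means of the truncations are not known. In place of a median
    of [u], a height T is fixed at which the weak type estimate leaves at least half of the [nu]
    measure of the part of B in E to the set {|u - u_B| <= T}. Every truncation used is constant on
    that set, with the value at its end nearer to u_B. *)

Lemma geometric_sum_le x n : 0 <= x < 1 -> \sum_(i < n) x ^+ i <= (1 - x)^-1.
Proof.
move=> /andP[x0 x1]; have x1' : 0 < 1 - x by rewrite subr_gt0.
rewrite -[leRHS]mul1r ler_pdivlMr// mulrC -opprB mulNr -subrX1 opprB.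
by rewrite gerBl exprn_ge0.
Qed.

Lemma ler_powR2l x y a : 0 <= a -> 0 <= x -> x <= y -> x `^ a <= y `^ a.
Proof.
by move=> a0 x0 xy; rewrite ge0_ler_powR// nnegrE// (le_trans x0).
Qed.

Lemma powRX x a i : 0 <= x -> (x ^+ i) `^ a = (x `^ a) ^+ i.
Proof.
by move=> x0; rewrite -(powR_mulrn _ x0) -powRrM mulrC powRrM powR_mulrn ?powR_ge0.
Qed.

Lemma powR_lt1 x a : 0 < x < 1 -> 0 < a -> 0 < x `^ a < 1.
Proof.
move=> /andP[x0 x1] a0; rewrite powR_gt0//= -[ltRHS](congr1 (@^~ a) (powR1 R)).
by apply: gt0_ltr_powR; rewrite ?nnegrE// ltW.
Qed.

Let decay c th sg := forall i j, (i <= j)%N -> sg j <= c * th ^+ (j - i) * sg i.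

(** The sequence need not be monotone. The first index with [sg i <= 1] becomes the reference: from
    it on, [decay] dominates [sg] by a geometric sequence. The induction on [n] shifts [sg] until
    that index comes first. *)
Lemma decay_sum_small c th a sg n : 0 < c -> 0 < th < 1 -> 0 < a ->
  (forall i, 0 < sg i) -> decay c th sg ->
  \sum_(i < n | sg i <= 1) sg i `^ a <= c `^ a / (1 - th `^ a).
Proof.
move=> c0 th01 a0; have /andP[ta0 ta1] := powR_lt1 th01 a0.
have /andP[th0 th1] := th01.
elim: n sg => [|n ih] sg sg0 dsg.
  by rewrite big_ord0 divr_ge0 ?powR_ge0// subr_ge0 ltW.
have [s1|s1] := leP (sg 0) 1; last first.
  rewrite big_mkcond/= big_ord_recl/= (leNgt (sg 0) 1) s1/= add0r.
  apply: le_trans (ih (fun i => sg i.+1) _ _) => // [|i j ij].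
    by rewrite [leRHS]big_mkcond.
  by rewrite -(subSS i) dsg.
apply: (@le_trans _ _ (\sum_(i < n.+1) c `^ a * (th `^ a) ^+ i)).
  rewrite big_mkcond/=; apply: ler_sum => i _; case: ifP => [_|_]; last first.
    by rewrite mulr_ge0 ?exprn_ge0 ?powR_ge0.
  rewrite -powRX ?(ltW th0)// -powRM ?exprn_ge0 ?(ltW th0) ?(ltW c0)//.
  apply: ler_powR2l; [exact: ltW|exact: ltW|].
  rewrite (le_trans (dsg 0 i _))// subn0.
  by rewrite ler_piMr// mulr_ge0 ?exprn_ge0 ?ltW.
rewrite -mulr_sumr ler_wpM2l ?powR_ge0// geometric_sum_le//.
by rewrite ltW.
Qed.

(** Here the last index with [1 < sg i] is the reference: read backwards from it, [decay] gives 1 <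
    c th^(n - i) sg i, so sg i^(-b) is geometric in the distance to it. *)
Lemma decay_sum_large c th b sg n : 0 < c -> 0 < th < 1 -> 0 < b ->
  (forall i, 0 < sg i) -> decay c th sg ->
  \sum_(i < n | 1 < sg i) sg i `^ (- b) <= c `^ b / (1 - th `^ b).
Proof.
move=> c0 th01 b0 sg0 dsg; have /andP[ta0 ta1] := powR_lt1 th01 b0.
have /andP[th0 th1] := th01.
elim: n => [|n ih].
  by rewrite big_ord0 divr_ge0 ?powR_ge0// subr_ge0 ltW.
have [s1|s1] := leP (sg n) 1.
  by rewrite big_mkcond/= big_ord_recr/= (ltNge 1 (sg _)) s1/= addr0 -big_mkcond.
apply: (@le_trans _ _ (\sum_(i < n.+1) c `^ b * (th `^ b) ^+ (n - i))).
  rewrite big_mkcond/=; apply: ler_sum => i _; case: ifP => [_|_]; last first.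
    by rewrite mulr_ge0 ?exprn_ge0 ?powR_ge0.
  rewrite -powRX ?(ltW th0)// -powRM ?exprn_ge0 ?(ltW th0) ?(ltW c0)//.
  rewrite powRN -[_^-1]div1r ler_pdivrMr ?powR_gt0// -powRM; last 2 first.
  - by rewrite mulr_ge0 ?exprn_ge0 ?ltW.
  - exact: ltW.
  rewrite -[leLHS](congr1 (@^~ b) (powR1 R)) ler_powR2l ?(ltW b0)//.
  by rewrite (le_trans (ltW s1))// dsg// -ltnS ltn_ord.
rewrite -mulr_sumr ler_wpM2l ?powR_ge0// (reindex_inj rev_ord_inj)/=.
under eq_bigr => i _ do rewrite subSS subKn -1?ltnS ?ltn_ord//.
by rewrite geometric_sum_le// ltW.
Qed.

(** With sigma = s x / G, the bounds coming from h <= s x and from h <= G share the factor G^(1/p -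
    1/q) s^(1/q); what is left is a positive power of sigma for the one and a negative power for the
    other. They agree at sigma = 1, where the choice switches. *)
Lemma powR_mul_le_min p q s G h x : 0 < p < q -> 0 < s -> 0 < G -> 0 < x ->
  0 <= h -> h <= G -> h <= s * x ->
  h `^ p^-1 * x `^ (- q^-1) <= G `^ (p^-1 - q^-1) * s `^ q^-1 *
    (if s * x / G <= 1 then (s * x / G) `^ (p^-1 - q^-1)
     else (s * x / G) `^ (- q^-1)).
Proof.
move=> /andP[p0 pq] s0 G0 x0 h0 hG hs; have q0 := lt_trans p0 pq.
have sx0 : 0 < s * x by exact: mulr_gt0.
have nz y : 0 < y -> y != 0 by move/gt_eqF/negbT.
have mono y : h <= y -> h `^ p^-1 * x `^ (- q^-1) <= y `^ p^-1 * x `^ (- q^-1).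
  by move=> hy; rewrite ler_wpM2r ?powR_ge0// ler_powR2l// invr_ge0 ltW.
have E y : (s * x / G) `^ y = s `^ y * x `^ y / G `^ y.
  rewrite powRM ?invr_ge0 ?(ltW G0) ?(ltW sx0)// powRM ?(ltW s0) ?(ltW x0)//.
  by rewrite -(powR_inv1 (ltW G0)) -powRrM mulN1r powRN.
have [Gp Gq xq sq] := And4 (nz _ (powR_gt0 p^-1 G0)) (nz _ (powR_gt0 q^-1 G0))
  (nz _ (powR_gt0 q^-1 x0)) (nz _ (powR_gt0 q^-1 s0)).
case: ifP => _; rewrite E.
- rewrite (le_trans (mono _ hs))// powRM ?(ltW s0) ?(ltW x0)//.
  rewrite !powRB ?nz ?implybT// powRN le_eqVlt; apply/orP; left; apply/eqP.
  by field; rewrite Gp Gq xq sq.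
- rewrite (le_trans (mono _ hG))// !powRB ?nz ?implybT// !powRN.
  rewrite le_eqVlt; apply/orP; left; apply/eqP.
  by field; rewrite Gq xq sq.
Qed.

Definition hedberg_cst p q c th : R :=
  c `^ (p^-1 - q^-1) / (1 - th `^ (p^-1 - q^-1)) +
  c `^ q^-1 / (1 - th `^ q^-1).

Lemma hedberg_cst_ge0 p q c th : 0 < p < q -> 0 < th < 1 ->
  0 <= hedberg_cst p q c th.
Proof.
move=> /andP[p0 pq] th01; have q0 := lt_trans p0 pq.
have a0 : 0 < p^-1 - q^-1 by rewrite subr_gt0 ltf_pV2.
have b0 : 0 < q^-1 by rewrite invr_gt0.
have /andP[_ ta1] := powR_lt1 th01 a0; have /andP[_ tb1] := powR_lt1 th01 b0.
by rewrite addr_ge0// divr_ge0 ?powR_ge0// subr_ge0 ltW.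
Qed.

(* Hedberg's trick: each term is bounded both through [h i <= G] and through
   [h i <= s * x i]; the first bound is summable over the indices with
   [x i > G / s], the second one over the others. *)
Lemma hedberg_sum p q c th s G (h x : nat -> R) n :
  0 < p < q -> 0 < c -> 0 < th < 1 -> 0 < s -> (forall i, 0 < x i) ->
  (forall i j, (i <= j)%N -> x j <= c * th ^+ (j - i) * x i) ->
  (forall i, 0 <= h i <= G) -> (forall i, h i <= s * x i) ->
  \sum_(i < n) h i `^ p^-1 * x i `^ (- q^-1) <=
  hedberg_cst p q c th * (G `^ (p^-1 - q^-1) * s `^ q^-1).
Proof.
move=> pq c0 th01 s0 x0 dx hG hs; have K0 := hedberg_cst_ge0 c pq th01.
have /andP[p0 pltq] := pq; have q0 := lt_trans p0 pltq.
have a0 : 0 < p^-1 - q^-1 by rewrite subr_gt0 ltf_pV2.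
have b0 : 0 < q^-1 by rewrite invr_gt0.
have := hG 0; move=> /andP[h00 hG0].
have [G0|G0] := leP G 0.
  rewrite big1 => [|i _]; first by rewrite !mulr_ge0 ?powR_ge0.
  have /andP[hi0 hiG] := hG i.
  have -> : h i = 0 by apply/eqP; rewrite eq_le hi0 (le_trans hiG).
  by rewrite powR0 ?mul0r// invr_neq0// gt_eqF.
pose sg i := s * x i / G.
have sg0 i : 0 < sg i by rewrite divr_gt0// mulr_gt0.
have dsg i j : (i <= j)%N -> sg j <= c * th ^+ (j - i) * sg i.
  move=> ij; have := dx _ _ ij; rewrite /sg; move: (th ^+ _) => t xj.
  rewrite (_ : _ * (_ / G) = s * (c * t * x i) / G); last by ring.
  by rewrite ler_pM2r ?invr_gt0// ler_pM2l.
apply: (@le_trans _ _ (\sum_(i < n) G `^ (p^-1 - q^-1) * s `^ q^-1 *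
    (if sg i <= 1 then sg i `^ (p^-1 - q^-1) else sg i `^ (- q^-1)))).
  apply: ler_sum => i _; have /andP[hi0 hiG] := hG i.
  exact: powR_mul_le_min.
rewrite -mulr_sumr mulrC ler_wpM2r ?mulr_ge0 ?powR_ge0//.
rewrite (bigID (fun i : 'I_n => sg i <= 1))/= lerD//.
  rewrite (eq_bigr (fun i : 'I_n => sg i `^ (p^-1 - q^-1))).
    exact: decay_sum_small.
  by move=> i ->.
under eq_bigl => i do rewrite -ltNge.
rewrite (eq_bigr (fun i : 'I_n => sg i `^ (- q^-1))).
  exact: decay_sum_large.
by move=> i; rewrite ltNge => /negbTE ->.
Qed.

End real_sums.

(** * Measures and covering *)

Section measure_lemmas.
Context {d} {T : measurableType d} {R : realType}.
Variable mu : {measure set T -> \bar R}.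
Implicit Types (D A B : set T) (f : T -> \bar R).

(** Only finitely many of the sets can have measure above 1/(n+1), as infinitely many would exhaust
    [mu A], and each positive measure is above some 1/(n+1). This enumerates disjoint balls in a
    space not assumed separable. *)
Lemma disjoint_measure_gt0_countable (J : pointedType) (D : set J) (F : J -> set T) A :
  measurable A -> mu A < +oo ->
  (forall i, D i -> [/\ measurable (F i), F i `<=` A & 0 < mu (F i)]) ->
  trivIset D F -> countable D.
Proof.
move=> mA Aoo DF tF.
rewrite [D](_ : _ = \bigcup_n [set i | D i /\ n.+1%:R^-1%:E < mu (F i)]); last first.
  apply/seteqP; split => [i Di|i [n _] []//].
  have [mF FA F0] := DF _ Di.
  have Ffin : mu (F i) \is a fin_num.
    rewrite ge0_fin_numE//; apply: le_lt_trans Aoo.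
    by rewrite le_measure ?inE.
  move: F0; rewrite -(fineK Ffin) lte_fin => /ltr_add_invr[k].
  by rewrite add0r => kF; exists k => //; split => //; rewrite -(fineK Ffin) lte_fin.
apply: bigcup_countable => // n _; apply: finite_set_countable.
apply: contrapT => /infiniteP/pcard_leP/injfunPex[/= g g_fun g_inj].
have gD k : D (g k) by have [] := g_fun k I.
have mFg k : measurable (F (g k)) by have [] := DF _ (gD k).
have tg : trivIset setT (F \o g).
  by move=> i j _ _ ij; apply: g_inj; rewrite ?inE//; exact: tF.
have N1 : (0 < n.+1%:R^-1 :> R)%R by rewrite invr_gt0.
have [m mA'] : exists m, (fine (mu A) < m%:R * n.+1%:R^-1)%R.
  exists (Num.bound (fine (mu A) * n.+1%:R)).
  by rewrite ltr_pdivlMr// archi_boundP// mulr_ge0// fine_ge0.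
have Afin : mu A \is a fin_num by rewrite ge0_fin_numE.
have : \sum_(k < m) mu (F (g k)) <= mu A.
  rewrite -(@measure_bigsetU _ _ _ mu (F \o g))//.
    rewrite le_measure ?inE//.
      by apply: bigsetU_measurable => i _; exact: mFg.
    rewrite -bigcup_mkord => x [k _] /=.
    by have [_ + _] := DF _ (gD k); apply.
apply/negP; rewrite -ltNge -(fineK Afin).
apply: (@lt_le_trans _ _ (\sum_(k < m) n.+1%:R^-1%:E)).
  rewrite sumEFin lte_fin big_const_ord iter_addr_0.
  by rewrite -[ltRHS]mulr_natl.
by apply: lee_sum => k _; have [_ /ltW] := g_fun k I.
Qed.

Lemma exists_dyadic (t y : R) : (0 < t)%R -> (t < y)%R ->
  exists k, (2 ^+ k * t < y <= 2 ^+ k.+1 * t)%R.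
Proof.
move=> t0 ty.
have ex : exists k, (y <= 2 ^+ k * t)%R.
  exists (Num.bound (y / t)); rewrite -ler_pdivrMr//.
  rewrite (le_trans (ltW (archi_boundP _)))//.
    by rewrite divr_ge0 ?ltW// (lt_trans t0).
  by rewrite -natrX ler_nat ltnW// ltn_expl.
case: (ex_minnP ex) => -[|k] yk kmin.
  by move: yk; rewrite expr0 mul1r leNgt ty.
by exists k; rewrite yk andbT ltNge; apply/negP => /kmin; rewrite ltnn.
Qed.

(** Pointwise, f^e is at most t^e plus the sum of (2^(k+1) t)^e over all k with 2^k t < f. Keeping
    all these k, and not only the last, produces superlevel sets, to which weak type bounds apply
    directly. *)
Lemma integral_poweR_le_dyadic D f (t e : R) : measurable D ->
  measurable_fun D f -> (forall x, D x -> 0 <= f x) -> (0 < t)%R -> (0 < e)%R ->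
  \int[mu]_(x in D) (f x `^ e) <= (t `^ e)%:E * mu D +
    \sum_(k <oo) ((2 ^+ k.+1 * t) `^ e)%:E *
      mu (D `&` [set x | (2 ^+ k * t)%:E < f x]).
Proof.
move=> mD mf f0 t0 e0.
pose S k := D `&` [set x | (2 ^+ k * t)%:E < f x].
have mS k : measurable (S k) by exact: emeasurable_fun_o_infty.
pose c k := ((2 ^+ k.+1 * t) `^ e)%:E.
have c0 k : 0 <= c k by rewrite lee_fin powR_ge0.
pose h k x := c k * (\1_(S k) x)%:E.
have h0 k x : 0 <= h k x by rewrite mule_ge0// lee_fin.
have mh k : measurable_fun D (h k).
  apply: emeasurable_funM => //.
  by apply/measurable_EFinP; exact: measurable_indic.
have hs0 x : 0 <= \sum_(k <oo) h k x by exact: nneseries_ge0.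
have -> : (t `^ e)%:E * mu D + \sum_(k <oo) c k * mu (S k) =
    \int[mu]_(x in D) ((t `^ e)%:E + \sum_(k <oo) h k x).
  rewrite ge0_integralD//; last 2 first.
  - by move=> x _; rewrite lee_fin powR_ge0.
  - exact: ge0_emeasurable_sum.
  rewrite integral_cst// integral_nneseries//; congr (_ + _).
  apply: eq_eseriesr => k _; rewrite ge0_integralZl//; last first.
    by apply/measurable_EFinP; exact: measurable_indic.
  by rewrite integral_indic// setIAC setIid.
have key x (y : R) : D x -> (0 <= y)%R -> y%:E <= f x ->
    (y `^ e)%:E <= (t `^ e)%:E + \sum_(k <oo) h k x.
  move=> Dx y0 yf; have [yt|ty] := leP y t.
    by rewrite (@le_trans _ _ (t `^ e)%:E) ?leeDl// lee_fin ler_powR2l// ltW.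
  have [k /andP[ky yk]] := exists_dyadic t0 ty.
  have Sx : S k x by split => //=; apply: lt_le_trans yf; rewrite lte_fin.
  apply: (@le_trans _ _ (\sum_(k <oo) h k x)).
    apply: le_trans (nneseries_lim_ge k.+1 _) => //.
    rewrite big_nat_recr//= -[leLHS]add0e leeD ?sume_ge0//.
    by rewrite /h indicE mem_set// mule1 lee_fin ler_powR2l// ltW.
  by rewrite leeDr// lee_fin powR_ge0.
apply: ge0_le_integral => //.
- by move=> x _; exact: poweR_ge0.
- exact: (measurableT_comp (measurable_poweR _)).
- by apply: emeasurable_funD => //; exact: ge0_emeasurable_sum.
move=> x Dx; have := f0 _ Dx; case Ef : (f x) => [y| |]// y0.
  by rewrite poweR_EFin key ?Ef// -lee_fin.
(* Where [f] is infinite, [key] applies to every real y; y = A^(1/e) shows that the right-hand side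
   is at least any given A. *)
rewrite poweRyr ?gt_eqF// leye_eq; apply/eqP/eq_infty => A.
have [A0|/ltW A0] := leP 0%R A; last first.
  by rewrite (@le_trans _ _ 0) ?lee_fin// adde_ge0// lee_fin powR_ge0.
have := @key x (A `^ e^-1)%R Dx (powR_ge0 _ _); rewrite Ef leey => /(_ isT).
by rewrite -powRrM mulVf ?gt_eqF// powRr1.
Qed.

End measure_lemmas.

(** A subset [P] of the naturals as index set treats finite and infinite families alike: in a
    series, the indices outside [P] carry the empty set. *)
Lemma countable_enumeration (J : pointedType) (D : set J) : countable D ->
  exists P : set nat, exists h : nat -> J, set_inj P h /\ D = h @` P.
Proof.
move=> /countable_bijP[P]; rewrite card_eq_sym => /pcard_eqP/bijPex[/= h hb].
case: hb => hf hi hs; exists P, h; split=> //; apply/seteqP; split => //.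
by move=> _ [k Pk <-]; exact: hf.
Qed.

(* A Vitali selection along the levels [n]: a maximal disjoint family of sets of
   level 0 is enlarged by a maximal disjoint family of sets of level 1 that avoid
   it, and so on. *)
Lemma level_disjoint_selection {T J : Type} (F : J -> set T) (lev : J -> nat)
    (S : set J) : (forall z, S z -> F z !=set0) ->
  exists D : set J, [/\ D `<=` S, trivIset D F &
    forall z, S z -> exists y, [/\ D y, (lev y <= lev z)%N & F z `&` F y !=set0]].
Proof.
move=> F0.
pose H n U := [set z | [/\ S z, lev z = n & forall y, U y -> F z `&` F y = set0]].
pose M A := sval (ex_maximal_disjoint_subcollection F A).
have MP A : maximal_disjoint_subcollection F (M A) A.
  exact: (svalP (ex_maximal_disjoint_subcollection F A)).
pose fix U n := if n is k.+1 then U k `|` M (H k (U k)) else set0.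
have US n : U n `<=` S.
  elim: n => [//|n ih] z /= [/ih//|]; have [MH _ _] := MP (H n (U n)).
  by move=> /MH[].
have Ulev n z : U n z -> (lev z < n)%N.
  elim: n => [//|n ih] /= [/ih/ltnW//|]; have [MH _ _] := MP (H n (U n)).
  by move=> /MH[_ ->].
have Umono i j : (i <= j)%N -> U i `<=` U j.
  by move=> /subnK <-; elim: (j - i)%N => [//|k ih] z /ih; left.
have Utriv n : trivIset (U n) F.
  elim: n => [|n ih] /= x y; first by case.
  have [MH tM _] := MP (H n (U n)).
  move=> [Ux|Mx] [Uy|My]; [exact: ih| | |exact: tM].
    have [_ _ /(_ _ Ux) + [t [Fx Fy]]] := MH _ My.
    by move=> /seteqP[/(_ t)]; case.
  have [_ _ /(_ _ Uy) + [t [Fx Fy]]] := MH _ Mx.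
  by move=> /seteqP[/(_ t)]; case.
exists (\bigcup_n U n); split.
- by move=> z [n _ /US].
- move=> x y [i _ Ux] [j _ Uy]; apply: (Utriv (maxn i j)).
    by apply: Umono Ux; rewrite leq_maxl.
  by apply: Umono Uy; rewrite leq_maxr.
move=> z Sz; set n := lev z.
have [MH tM Mmax] := MP (H n (U n)).
apply: contrapT => /forallNP noy.
have disj y : U n.+1 y -> F z `&` F y = set0.
  move=> Uy; apply/eqP/negPn/negP => /set0P FF; apply: (noy y); split => //.
    by exists n.+1.
  exact: Ulev Uy.
have Hz : H n (U n) z by split => // y Uy; apply: disj; left.
(* A [z] that meets nothing selected up to its own level could be added to the family of that level,
   against maximality. It would be a new member because [F z] is nonempty and so meets itself. *)
apply: (Mmax (M (H n (U n)) `|` [set z])).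
- split; first by left.
  move=> /(_ z (or_intror erefl)) Mz.
  have /F0[t Ft] := Sz; have := disj z (or_intror Mz).
  by rewrite setIid => /seteqP[/(_ t)]; case.
- by move=> y [/MH//|->].
- move=> x y [Mx|->] [My|->]; [exact: tM| | |by []].
    by rewrite setIC disj => [[]|]//; right.
  by rewrite disj => [[]|]//; right.
Qed.

(** * Doubling and the maximal function *)

Section metric_measure_lemmas.
Context {R : realType} {X : pmetricType R}.
Implicit Types (x y : X) (r s t : R) (E : set X).

Lemma ball_subD x y r s t : ball x s y -> (s + t <= r)%R -> ball y t `<=` ball x r.
Proof. by move=> xy sr z yz; apply: (le_ball sr); exact: ball_triangle yz. Qed.

Lemma metric_ball_open x r : open (ball x r).
Proof.
rewrite openE => y; rewrite ballEmdist/= => xy; apply/nbhs_ballP.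
exists (r - mdist x y)%R; rewrite /= ?subr_gt0// => z; rewrite !ballEmdist/=.
by rewrite ltrBrDl; apply: le_lt_trans; exact: metric_triangle.
Qed.

Lemma measurable_ball G (mu : {measure set (g_sigma_algebraType G) -> \bar R}) x r :
  complete_Borel mu -> measurable (ball x r : set (g_sigma_algebraType G)).
Proof. by move=> [oM _]; apply: oM; exact: metric_ball_open. Qed.

Section doubling.
Variables (G : set (set X)) (mu : {measure set (g_sigma_algebraType G) -> \bar R}).
Variables (E : set X) (r0 C : R).
Hypotheses (bmu : complete_Borel mu) (C0 : (0 < C)%R) (dmu : doubling_on mu E r0 C).

Lemma le_mu_ball x r (A : set X) : measurable (A : set (g_sigma_algebraType G)) ->
  ball x r `<=` A -> mu (ball x r) <= mu A.
Proof.
move=> mA sA; apply: le_measure; rewrite ?inE//.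
exact: (measurable_ball _ _ bmu).
Qed.

Lemma mu_ball_gt0 x r : E x -> (0 < r <= r0)%R -> 0 < mu (ball x r).
Proof.
move=> Ex rr; have [m0 mC _] := dmu Ex rr; rewrite lt0e measure_ge0 andbT.
by apply: contraPneq (lt_le_trans m0 mC) => ->; rewrite mule0 ltxx.
Qed.

Lemma mu_ball_fin x r : E x -> (0 < r <= r0)%R -> mu (ball x r) \is a fin_num.
Proof.
move=> Ex rr; have [_ _ mC] := dmu Ex rr; rewrite ge0_fin_numE//.
by move: mC; case: (mu _) => [m|/=|]; rewrite ?ltry// gt0_muley.
Qed.

Lemma mu_ball_fine_gt0 x r : E x -> (0 < r <= r0)%R -> (0 < fine (mu (ball x r)))%R.
Proof. by move=> Ex rr; rewrite fine_gt0// mu_ball_gt0// ltey_eq mu_ball_fin. Qed.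

(** The final radius may reach 2 r0, since the last doubling only has to start from a radius at most
    r0. *)
Lemma mu_ball_doubling x r k : E x -> (0 < r)%R -> (2 ^+ k * r <= 2 * r0)%R ->
  mu (ball x (2 ^+ k * r)) <= (C ^+ k)%:E * mu (ball x r).
Proof.
move=> Ex r_gt0; elim: k => [|k ih] kr; first by rewrite !expr0 mul1r mul1e.
have kr' : (2 ^+ k * r <= r0)%R.
  by move: kr; rewrite exprS -mulrA ler_pM2l.
have kr0 : (0 < 2 ^+ k * r)%R by rewrite mulr_gt0// exprn_gt0.
have [|_ + _] := dmu Ex (r := (2 ^+ k * r)%R); first by rewrite kr0.
rewrite mulrA -exprS => /le_trans; apply.
rewrite exprS EFinM -muleA lee_pmul2l ?lte_fin//.
apply: ih; rewrite (le_trans kr')// ler_peMl// ?ler1n//.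
by rewrite (le_trans _ kr')// ltW.
Qed.

Lemma doubling_cst_ge1 x : E x -> (0 < r0)%R -> (1 <= C)%R.
Proof.
move=> Ex r00; have rr : (0 < r0 <= r0)%R by rewrite r00 lexx.
have [_ + _] := dmu Ex rr; have mf := mu_ball_fin Ex rr.
have m0 := mu_ball_fine_gt0 Ex rr; move=> mC.
rewrite -(ler_pM2r m0) mul1r -lee_fin EFinM (fineK mf) (le_trans _ mC)//.
apply: le_mu_ball; first exact: (measurable_ball _ _ bmu).
by apply: le_ball; rewrite ler_peMl ?ler1n// ltW.
Qed.

End doubling.

(** Only the centres of the bad balls have to be covered. A bad ball of level i meets a selected
    ball of level at most i, hence of at least the same radius, so its centre lies in the double of
    the selected ball. The double has radius 2 lam rho <= 2^(k+1) rho, which costs C^(k+1); the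
    lower bound on [2 * lam] keeps these doublings within the admissible radii. *)
Lemma maximal_weak_type (Gmu Gnu : set (set X))
    (mu : {measure set (g_sigma_algebraType Gmu) -> \bar R})
    (nu : {measure set (g_sigma_algebraType Gnu) -> \bar R})
    E (r0 C lam r s : R) (k : nat) (x0 : X) (phi : X -> \bar R) :
  complete_Borel mu -> complete_Borel nu -> (0 < C)%R -> doubling_on nu E r0 C ->
  E x0 -> (0 < r)%R -> (1 <= lam)%R -> (2 * lam * r <= r0)%R ->
  (2 ^+ k < 2 * lam <= 2 ^+ k.+1)%R -> (0 < s)%R ->
  measurable_fun (ball x0 (2 * lam * r) : set (g_sigma_algebraType Gmu)) phi ->
  (forall x, 0 <= phi x) ->
  exists W : set X, [/\ measurable (W : set (g_sigma_algebraType Gnu)),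
    forall x, E x -> ball x0 r x ->
      (exists i, s%:E * nu (ball x (r / 2 ^+ i)) <
        \int[mu]_(y in ball x (lam * (r / 2 ^+ i))) phi y) -> W x
    & nu W <= (C ^+ k.+1 / s)%:E * \int[mu]_(y in ball x0 (2 * lam * r)) phi y].
Proof.
move=> bmu bnu C0 dnu Ex0 r_gt0 lam1 lr /andP[k1 k2] s0 mphi phi0.
have lam0 : (0 < lam)%R by rewrite (lt_le_trans ltr01).
pose rho i : R := (r / 2 ^+ i)%R.
have rho0 i : (0 < rho i)%R by rewrite divr_gt0// exprn_gt0.
have rhor i : (rho i <= r)%R.
  by rewrite /rho ler_pdivrMr ?exprn_gt0// ler_peMr ?exprn_ege1 ?ler1n// ltW.
have rho_le i j : (i <= j)%N -> (rho j <= rho i)%R.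
  move=> ij; rewrite /rho ler_pM2l// lef_pV2 ?posrE ?exprn_gt0//.
  by rewrite ler_eXn2l ?ltr1n.
have lrho0 i : (0 < lam * rho i)%R by rewrite mulr_gt0.
have lrho i : (2 * lam * rho i <= r0)%R.
  by rewrite (le_trans _ lr)// ler_pM2l ?mulr_gt0.
have lrho' i : (0 < lam * rho i <= r0)%R.
  by rewrite lrho0 (le_trans _ (lrho i))// -mulrA ler_peMl ?ler1n// ltW.
pose A := ball x0 (2 * lam * r).
pose F (z : X * nat) := ball z.1 (lam * rho z.2).
pose S := [set z : X * nat | [/\ E z.1, ball x0 r z.1 &
  s%:E * nu (ball z.1 (rho z.2)) < \int[mu]_(y in F z) phi y]].
have FA z : S z -> F z `<=` A.
  move=> [_ zx _]; apply: (ball_subD zx).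
  rewrite -mulrA mulrDl mul1r lerD//; first by rewrite ler_peMl// ltW.
  by rewrite ler_pM2l.
have F0 z : S z -> F z !=set0 by move=> _; exists z.1; exact: ballxx.
have [D [DS tD Dcov]] := level_disjoint_selection snd F0.
have cD : countable D.
  apply: (@disjoint_measure_gt0_countable _ _ _ nu _ D F A) => //.
  - exact: (measurable_ball _ _ bnu).
  - rewrite ltey_eq (mu_ball_fin C0 dnu)//.
    by rewrite lr mulr_gt0// mulr_gt0.
  - move=> z /DS Sz; split; [exact: (measurable_ball _ _ bnu)|exact: FA|].
    by have [Ez _ _] := Sz; exact: (mu_ball_gt0 dnu).
have [P [h [hinj DE]]] := countable_enumeration cD.
have SP n : P n -> S (h n) by move=> Pn; apply: DS; rewrite DE; exists n.
pose V (z : X * nat) := ball z.1 (2 * lam * rho z.2).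
have mV z : measurable (V z : set (g_sigma_algebraType Gnu)).
  exact: (measurable_ball _ _ bnu).
have mF z : measurable (F z : set (g_sigma_algebraType Gmu)).
  exact: (measurable_ball _ _ bmu).
pose W n := if n \in P then V (h n) else set0.
pose H n := if n \in P then F (h n) else set0.
have mW n : measurable (W n : set (g_sigma_algebraType Gnu)).
  by rewrite /W; case: ifP.
have mH n : measurable (H n : set (g_sigma_algebraType Gmu)).
  by rewrite /H; case: ifP.
have mUW : measurable (\bigcup_n W n : set (g_sigma_algebraType Gnu)).
  exact: bigcup_measurable.
have HA n : H n `<=` A.
  by move=> z; rewrite /H; case: ifPn => [/set_mem Pn|_ []]; apply: FA; exact: SP.
exists (\bigcup_n W n); split => //.
  move=> x Ex xx0 [i xi]; have [|y [Dy yi [t [xt yt]]]] := Dcov (x, i).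
    by split.
  move: (Dy); rewrite DE => -[n Pn hn].
  exists n => //; rewrite /W mem_set// /V hn.
  rewrite (_ : 2 * lam * _ = lam * rho y.2 + lam * rho y.2)%R; last by ring.
  apply: (ball_triangle yt); apply/ball_sym; apply: le_ball xt => /=.
  by rewrite ler_pM2l// rho_le.
have tH : trivIset setT H.
  move=> i j _ _ [t []]; rewrite /H; case: ifPn => [/set_mem Pi|_ []].
  case: ifPn => [/set_mem Pj|_ _ []] ti tj; apply: hinj; rewrite ?inE//.
  by apply: tD; [rewrite DE; exists i|rewrite DE; exists j|exists t].
apply: (@le_trans _ _ (\sum_(n <oo) nu (W n))).
  exact: generalized_Boole_inequality.
have c0 : (0 <= C ^+ k.+1 / s)%R by rewrite divr_ge0 ?exprn_ge0// ltW.
apply: (@le_trans _ _ (\sum_(n <oo) (C ^+ k.+1 / s)%:E * \int[mu]_(y in H n) phi y)).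
  apply: lee_nneseries => // n _; rewrite /W /H; case: ifPn => [/set_mem Pn|_].
    have [Eh _ hlt] := SP _ Pn.
    apply: (@le_trans _ _ ((C ^+ k.+1)%:E * nu (ball (h n).1 (rho (h n).2)))).
      apply: le_trans (mu_ball_doubling C0 dnu Eh (rho0 _) _).
        apply: (le_mu_ball bnu); first exact: (measurable_ball _ _ bnu).
        by apply: le_ball; rewrite ler_pM2r.
      rewrite exprS -mulrA ler_pM2l// (le_trans _ (lrho (h n).2))//.
      by rewrite ler_pM2r// ltW.
    rewrite EFinM -muleA lee_pmul2l ?lte_fin ?exprn_gt0//.
    by rewrite lee_pdivlMl// ltW.
  by rewrite measure0 integral_set0 mule0.
rewrite nneseriesZl; last by move=> n _; exact: integral_ge0.
rewrite lee_wpmul2l ?lee_fin// -ge0_integral_bigcup//; last first.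
  apply: measurable_funS mphi; first exact: (measurable_ball _ _ bmu).
  by apply: bigcup_sub => n _; exact: HA.
apply: ge0_subset_integral => //.
- exact: bigcup_measurable.
- exact: (measurable_ball _ _ bmu).
- by apply: bigcup_sub => n _; exact: HA.
Qed.

End metric_measure_lemmas.

(** * Means *)

Section means.
Context {d} {T : measurableType d} {R : realType}.
Variable mu : {measure set T -> \bar R}.
Implicit Types (A B : set T) (v : T -> \bar R) (k c : R).

Lemma integrable_cstr A k : measurable A -> mu A < +oo ->
  mu.-integrable A (cst k%:E).
Proof.
move=> mA Aoo; apply/integrableP; split => //.
by rewrite /= integral_cst//= lte_mul_pinfty.
Qed.

Lemma mean_fin_num A v : measurable A -> 0 < mu A -> mu.-integrable A v ->
  mean mu A v \is a fin_num.
Proof.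
move=> mA A0 iv; rewrite /mean fin_numM ?integrable_fin_num//.
move: A0; case: (mu A) => [a|_|//]; last by rewrite invey.
by rewrite lte_fin inver => /gt_eqF ->.
Qed.

Lemma mean_ge0 A v : (forall x, A x -> 0 <= v x) -> 0 <= mean mu A v.
Proof. by move=> v0; rewrite mule_ge0 ?inve_ge0 ?measure_ge0 ?integral_ge0. Qed.

Lemma le_mean A v w : measurable A -> (forall x, A x -> 0 <= v x <= w x) ->
  measurable_fun A v -> measurable_fun A w -> mean mu A v <= mean mu A w.
Proof.
move=> mA vw mv mw; rewrite lee_wpmul2l ?inve_ge0 ?measure_ge0//.
by apply: ge0_le_integral => // x /vw/andP[].
Qed.

Lemma measurable_dist A v k : measurable_fun A v ->
  measurable_fun A (fun x => `|v x - k%:E|).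
Proof. by move=> mv; apply: measurableT_comp => //; exact: emeasurable_funB. Qed.

(** Two uses: with k the mean over B and c a doubling factor it compares means over nested balls;
    with A = B and c = 1 it compares the mean of a truncation with the truncated mean. *)
Lemma mean_subset_dist A B v k c : measurable A -> measurable B -> A `<=` B ->
  0 < mu A -> mu B < +oo -> mu B <= c%:E * mu A -> mu.-integrable B v ->
  `|mean mu A v - k%:E| <= c%:E * mean mu B (fun x => `|v x - k%:E|).
Proof.
move=> mA mB AB A0 Boo BA iv.
have iAv := integrableS mB mA AB iv.
have AleB : mu A <= mu B by rewrite le_measure ?inE.
have Aoo : mu A < +oo := le_lt_trans AleB Boo.
have ick := integrable_cstr k mA Aoo.
have mvk := measurable_dist k (measurable_int _ iv).
have {A0 AleB BA Boo} [a [b [a0 b0 muA muB bca]]] : exists a b : R,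
    [/\ (0 < a)%R, (0 < b)%R, mu A = a%:E, mu B = b%:E & (b <= c * a)%R].
  exists (fine (mu A)), (fine (mu B)).
  have Af : mu A \is a fin_num by rewrite ge0_fin_numE.
  have Bf : mu B \is a fin_num by rewrite ge0_fin_numE.
  rewrite !fineK// -!lte_fin -lee_fin EFinM !fineK//; split => //.
  exact: lt_le_trans AleB.
have -> : mean mu A v - k%:E = a^-1%:E * \int[mu]_(x in A) (v x - k%:E).
  rewrite [in RHS]integralB// integral_cst//= /mean muA inver gt_eqF//.
  have fv := integrable_fin_num mA iAv.
  rewrite -EFinM -(fineK fv) -EFinB -EFinM; congr EFin.
  by field; rewrite gt_eqF.
rewrite abseM gee0_abs ?lee_fin ?invr_ge0 ?(ltW a0)//.
apply: (@le_trans _ _ (a^-1%:E * \int[mu]_(x in B) `|v x - k%:E|)).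
  rewrite lee_pmul2l ?lte_fin ?invr_gt0//.
  apply: le_trans (le_abse_integral _ _ _) _ => //.
    by apply: emeasurable_funB => //; exact: measurable_int iAv.
  exact: ge0_subset_integral.
rewrite /mean muB inver gt_eqF// muleA -EFinM lee_wpmul2r ?integral_ge0//.
by rewrite lee_fin ler_pdivlMr// mulrC ler_pdivrMr.
Qed.

End means.

(** * From weak type to integral estimates *)

Section weak_strong.
Context {d} {T : measurableType d} {R : realType}.
Variable mu : {measure set T -> \bar R}.
Implicit Types (D : set T) (f : T -> \bar R).

Lemma nneseries_le_bound (u : (\bar R)^nat) (b : \bar R) : (forall n, 0 <= u n) ->
  (forall n, \sum_(0 <= i < n) u i <= b) -> \sum_(i <oo) u i <= b.
Proof.
move=> u0 ub; apply: lime_le; last exact: nearW.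
exact: is_cvg_nneseries.
Qed.

(** The inequality e^x >= 1 + x at x = s ln 2. With s = q - q' it is the source of the factor 1 / (q
    - q') in part (i). *)
Lemma inv_one_sub_powR_le (s : R) : (0 < s)%R ->
  ((1 - 2 `^ (- s))^-1 <= 2 `^ s / (s * ln 2))%R.
Proof.
move=> s0; have ln2 : (0 < ln 2 :> R)%R by rewrite ln_gt0// ltr1n.
have e1 : (1 + s * ln 2 <= 2 `^ s :> R)%R.
  by rewrite /powR ifF ?pnatr_eq0// expR_ge1Dx.
have s2 : (0 < s * ln 2)%R by rewrite mulr_gt0.
have p2 : (0 < 2 `^ s :> R)%R by rewrite powR_gt0.
rewrite powRN -[leLHS]mul1r ler_pdivrMr; last first.
  by rewrite subr_gt0 invf_lt1//; lra.
rewrite mulrAC ler_pdivlMr// mul1r mulrBr mulr1 mulfV ?gt_eqF//; lra.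
Qed.

(** A sum of two numerators over q - q': q from 1 <= q / (q - q'), for the values below the first
    dyadic level, and 2^q / ln 2 from the geometric series of ratio 2^(q' - q). *)
Definition weak_int_cst (q : R) : R := (q + 2 `^ q / ln 2)%R.

Lemma weak_int_cst_gt0 (q : R) : (0 < q)%R -> (0 < weak_int_cst q)%R.
Proof. by move=> q0; rewrite addr_gt0// divr_gt0 ?powR_gt0// ln_gt0// ltr1n. Qed.

Let weak_integral_le_pos D f (A q q' N : R) : measurable D -> mu D = N%:E ->
  (0 < N)%R -> measurable_fun D f -> (forall x, D x -> 0 <= f x) ->
  (1 <= q')%R -> (q' < q)%R -> (0 < A)%R ->
  (forall y, (0 < y)%R -> mu (D `&` [set x | y%:E < f x]) <= ((A / y) `^ q)%:E) ->
  (\int[mu]_(x in D) (f x `^ q')) `^ q'^-1 <=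
  (weak_int_cst q * A * (N `^ (q'^-1 - q^-1) / (q - q')))%:E.
Proof.
move=> mD muD N0 mf f0 q'1 q'q A0 wk.
have q'0 : (0 < q')%R by exact: lt_le_trans q'1.
have q0 : (0 < q)%R by exact: lt_trans q'q.
have s0 : (0 < q - q')%R by rewrite subr_gt0.
have ln2 : (0 < ln 2 :> R)%R by rewrite ln_gt0// ltr1n.
(* At this height the weak type bound (A / t)^q equals the trivial bound N; the dyadic levels start
   here. *)
pose t := (A * N `^ (- q^-1))%R.
have t0 : (0 < t)%R by rewrite mulr_gt0// powR_gt0.
have At : (A / t = N `^ q^-1)%R.
  by rewrite /t powRN invfM invrK mulrA mulfV ?gt_eqF// mul1r.
have tE : t = (A * N `^ (- q^-1))%R by [].
clearbody t.
pose z : R := (2 `^ (q' - q))%R.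
have z01 : (0 <= z < 1)%R.
  rewrite /z -opprB powRN invr_ge0 powR_ge0/= invf_lt1 ?powR_gt0//.
  rewrite -[ltLHS](powRr0 2) /powR !ifF ?pnatr_eq0// mul0r ltr_expR.
  by rewrite mulr_gt0.
have intle : \int[mu]_(x in D) (f x `^ q') <=
    (t `^ q' * N * (weak_int_cst q / (q - q')))%:E.
  apply: le_trans (integral_poweR_le_dyadic mu mD mf f0 t0 q'0) _.
  rewrite muD -EFinM.
  have term k : ((2 ^+ k.+1 * t) `^ q' * (A / (2 ^+ k * t)) `^ q =
      t `^ q' * N * 2 `^ q' * z ^+ k)%R.
    rewrite [(A / _)%R](_ : _ = N `^ q^-1 * (2 ^+ k)^-1)%R; last first.
      by rewrite -At; field; rewrite expf_neq0// gt_eqF.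
    rewrite exprS !powRM ?mulr_ge0 ?invr_ge0 ?exprn_ge0 ?powR_ge0 ?(ltW t0)//.
    rewrite -powRrM mulVf ?gt_eqF// powRr1 ?(ltW N0)//.
    rewrite -(powR_inv1 (exprn_ge0 _ _))// -powRrM mulN1r powRN !powRX//.
    rewrite /z powRB ?pnatr_eq0 ?implybT// expr_div_n.
    by field; rewrite expf_neq0// gt_eqF// powR_gt0.
  have tN0 : (0 <= t `^ q' * N * 2 `^ q')%R by rewrite !mulr_ge0 ?powR_ge0 ?ltW.
  apply: (@le_trans _ _ ((t `^ q' * N)%:E +
      (t `^ q' * N * 2 `^ q' * (1 - z)^-1)%:E)).
    rewrite leeD2l//; apply: nneseries_le_bound => [k|n].
      by rewrite mule_ge0// lee_fin powR_ge0.
    apply: (@le_trans _ _ (\sum_(0 <= k < n) (t `^ q' * N * 2 `^ q' * z ^+ k)%:E)).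
      apply: lee_sum => k _; rewrite -term [leRHS]EFinM lee_wpmul2l ?lee_fin ?powR_ge0//.
      by apply: wk; rewrite mulr_gt0// exprn_gt0.
    rewrite sumEFin lee_fin -mulr_sumr ler_wpM2l//.
    by rewrite big_mkord geometric_sum_le.
  rewrite -EFinD lee_fin.
  rewrite [leLHS](_ : _ = t `^ q' * N * (1 + 2 `^ q' * (1 - z)^-1))%R; last by ring.
  rewrite ler_wpM2l ?mulr_ge0 ?powR_ge0 ?(ltW N0)//.
  have zE : z = (2 `^ (- (q - q')))%R by rewrite /z opprB.
  have := inv_one_sub_powR_le s0; rewrite -zE => zle.
  apply: (@le_trans _ _ (q / (q - q') + 2 `^ q' * (2 `^ (q - q') / ((q - q') * ln 2)))%R).
    apply: lerD; last by rewrite ler_wpM2l ?powR_ge0.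
    by rewrite ler_pdivlMr// mul1r gerBl ltW.
  rewrite [(2 `^ q' * _)%R]mulrA -powRD ?pnatr_eq0 ?implybT// [(q' + _)%R]addrC subrK.
  rewrite le_eqVlt; apply/orP; left; apply/eqP; rewrite /weak_int_cst.
  by field; rewrite !gt_eqF.
have B1 : (1 <= weak_int_cst q / (q - q'))%R.
  rewrite ler_pdivlMr// mul1r /weak_int_cst.
  rewrite (@le_trans _ _ q) ?gerBl ?(ltW q'0)// lerDl divr_ge0 ?powR_ge0 ?ltW//.
have wB0 : (0 <= weak_int_cst q / (q - q'))%R := le_trans ler01 B1.
have tNB : (0 <= t `^ q' * N * (weak_int_cst q / (q - q')))%R.
  by apply: mulr_ge0 => //; rewrite mulr_ge0 ?powR_ge0 ?(ltW N0).
apply: le_trans (gt0_ler_poweR _ _ _ intle) _.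
- by rewrite invr_ge0 ltW.
- by rewrite in_itv/= leey andbT integral_ge0// => x _; exact: poweR_ge0.
- by rewrite in_itv/= leey andbT lee_fin.
rewrite poweR_EFin lee_fin [leLHS]powRM//; last first.
  by rewrite mulr_ge0 ?powR_ge0 ?(ltW N0).
rewrite powRM ?powR_ge0 ?(ltW N0)// -powRrM mulfV ?gt_eqF// powRr1 ?(ltW t0)//.
(* The last factor is at least 1 by [B1] and 1/q' <= 1, so its root may be replaced by the factor
   itself. *)
apply: (@le_trans _ _ (t * N `^ q'^-1 * (weak_int_cst q / (q - q')))%R).
  rewrite ler_wpM2l ?mulr_ge0 ?powR_ge0 ?(ltW t0)//.
  by rewrite ler1_powR// invf_le1.
rewrite tE powRD; last by rewrite (gt_eqF N0) implybT.
by rewrite le_eqVlt; apply/orP; left; apply/eqP; ring.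
Qed.

(** When [A] vanishes there is no positive starting height. [A] is enlarged by a multiple of an
    arbitrary e > 0, chosen to change the final bound by at most e. *)
Lemma weak_integral_le D f (A q q' N : R) : measurable D -> mu D = N%:E ->
  (0 < N)%R -> measurable_fun D f -> (forall x, D x -> 0 <= f x) ->
  (1 <= q')%R -> (q' < q)%R -> (0 <= A)%R ->
  (forall y, (0 < y)%R -> mu (D `&` [set x | y%:E < f x]) <= ((A / y) `^ q)%:E) ->
  (\int[mu]_(x in D) (f x `^ q')) `^ q'^-1 <=
  (weak_int_cst q * A * (N `^ (q'^-1 - q^-1) / (q - q')))%:E.
Proof.
move=> mD muD N0 mf f0 q'1 q'q A0 wk.
have q0 : (0 < q)%R by rewrite (lt_trans _ q'q)// (lt_le_trans _ q'1).
set c := (N `^ _ / _)%R; have c0 : (0 <= c)%R.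
  by rewrite divr_ge0 ?powR_ge0// subr_ge0 ltW.
have W0 := weak_int_cst_gt0 q0.
have cW0 : (0 < weak_int_cst q * c + 1)%R by rewrite ltr_wpDl// mulr_ge0// ltW.
apply/lee_addgt0Pr => e e0; rewrite -EFinD.
pose A' := (A + e / (weak_int_cst q * c + 1))%R.
have A'0 : (0 < A')%R by rewrite ltr_wpDl// divr_gt0.
apply: le_trans (weak_integral_le_pos mD muD N0 mf f0 q'1 q'q A'0 _) _.
  move=> y y0; apply: le_trans (wk _ y0) _.
  rewrite lee_fin ler_powR2l// ?divr_ge0 ?(ltW q0) ?(ltW y0)//.
  by rewrite ler_pM2r ?invr_gt0// lerDl divr_ge0// ltW.
rewrite lee_fin -/c /A'; set w := weak_int_cst q in cW0 *.
rewrite (_ : w * _ * c = w * A * c + e / (w * c + 1) * (w * c))%R; last by ring.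
by rewrite lerD2l mulrAC ler_pdivrMr// ler_pM2l// lerDl.
Qed.

(** At the exponent q itself the factors 2^(kq) of the dyadic sum and of the weak bounds cancel, so
    convergence has to come from the [c k]. *)
Lemma integral_poweR_le_dyadic_sum D f (t q : R) (c : nat -> R) :
  measurable D -> measurable_fun D f -> (forall x, D x -> 0 <= f x) ->
  (0 < t)%R -> (0 < q)%R ->
  (forall k, mu (D `&` [set x | (2 ^+ k * t)%:E < f x]) <=
             (c k / (2 ^+ k * t) `^ q)%:E) ->
  \int[mu]_(x in D) (f x `^ q) <=
  (t `^ q)%:E * mu D + (2 `^ q)%:E * \sum_(k <oo) (c k)%:E.
Proof.
move=> mD mf f0 t0 q0 wk.
apply: le_trans (integral_poweR_le_dyadic mu mD mf f0 t0 q0) _.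
have p0 k : (0 < (2 ^+ k * t) `^ q)%R by rewrite powR_gt0// mulr_gt0// exprn_gt0.
have c0 k : (0 <= c k)%R.
  have := le_trans (measure_ge0 _ _) (wk k).
  by rewrite lee_fin pmulr_lge0// invr_gt0.
rewrite leeD2l// -nneseriesZl; last by move=> k _; rewrite lee_fin.
apply: lee_nneseries => [k _ _|k _].
  by rewrite mule_ge0// lee_fin powR_ge0.
apply: le_trans (lee_wpmul2l _ (wk k)) _; first by rewrite lee_fin powR_ge0.
rewrite -!EFinM lee_fin exprS -mulrA powRM ?mulr_ge0 ?exprn_ge0 ?(ltW t0)//.
by rewrite -mulrA ler_pM2l ?powR_gt0// mulrCA mulfV ?gt_eqF// mulr1.
Qed.

End weak_strong.

(** * Measurability of functions given by their Lebesgue values *)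

Section measurability.
Context {R : realType} {X : pmetricType R} {Gmu Gnu : set (set X)}.
Variables (mu : {measure set (g_sigma_algebraType Gmu) -> \bar R})
  (nu : {measure set (g_sigma_algebraType Gnu) -> \bar R}).
Variables (E : set X) (r0 C : R).
Hypotheses (bmu : complete_Borel mu) (bnu : complete_Borel nu).
Hypotheses (C0 : (0 < C)%R) (r00 : (0 < r0)%R) (dmu : doubling_on mu E r0 C).

Let mB (x : X) (r : R) : measurable (ball x r : set (g_sigma_algebraType Gmu)).
Proof. exact: (measurable_ball _ _ bmu). Qed.

(* For measurable [w] this is lower semicontinuity in the centre of the ball,
   which makes means Borel functions of the centre. *)
Lemma ball_integral_open (w : X -> \bar R) (r a : R) : (forall x, 0 <= w x) ->
  (forall x, measurable_fun (ball x r : set (g_sigma_algebraType Gmu)) w) ->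
  open [set x : X | a%:E < \int[mu]_(y in ball x r) w y].
Proof.
move=> w0 mw; rewrite openE => x /= ax.
(* These concentric balls exhaust the open ball, so one of them already carries an integral above a;
   it stays inside [ball y r] for every y within 1/(n+1) of x. *)
pose F n : set (g_sigma_algebraType Gmu) := ball x (r - n.+1%:R^-1)%R.
have Fr n : F n `<=` ball x r by apply: le_ball; rewrite gerBl.
have mF n : measurable (F n) by exact: mB.
have mwF n : measurable_fun (F n) w by exact: measurable_funS (mw x).
have UF : \bigcup_n F n = ball x r.
  apply/seteqP; split => [y [n _ /Fr]//|y].
  rewrite ballEmdist/= => xy.
  have : (0 < r - mdist x y)%R by rewrite subr_gt0.
  move=> /ltr_add_invr[n]; rewrite add0r => nxy; exists n => //.
  by rewrite /F ballEmdist/= ltrBrDl -ltrBrDr.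
have ndF : nondecreasing_seq F.
  move=> m n mn; apply/subsetPset; apply: le_ball.
  by rewrite lerD2l lerN2 lef_pV2 ?posrE ?ltr0n// ler_nat.
have [n an] : exists n, a%:E < \int[mu]_(y in F n) w y.
  apply: contrapT => /forallNP nF; move: ax; apply/negP; rewrite -leNgt.
  have cF := ge0_nondecreasing_set_cvg_integral ndF mF mwF
    (fun _ y _ => w0 y) (mu := mu).
  rewrite -UF -(cvg_lim _ cF)//; apply: lime_le.
    by apply/cvg_ex; eexists; exact: cF.
  by apply: nearW => n; rewrite leNgt; apply/negP.
apply/nbhs_ballP; exists (n.+1%:R^-1)%R; rewrite /= ?invr_gt0// => y xy.
apply: lt_le_trans an _.
apply: ge0_subset_integral; [exact: mF|exact: mB|exact: mw|by []|].
by apply: (ball_subD (ball_sym xy)); rewrite addrC subrK.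
Qed.

Lemma measurable_ball_integral (w : X -> \bar R) (r : R) : (forall x, 0 <= w x) ->
  (forall x, measurable_fun (ball x r : set (g_sigma_algebraType Gmu)) w) ->
  measurable_fun (setT : set (g_sigma_algebraType Gnu))
    (fun x => \int[mu]_(y in ball x r) w y).
Proof.
move=> w0 mw; apply: (measurability _ (ErealGenOInfty.measurableE R)).
move=> _ [_ [a ->] <-]; rewrite setTI.
apply: (bnu.1); have := ball_integral_open a w0 mw.
by congr open; apply/seteqP; split => x /=; rewrite in_itv/= andbT.
Qed.

(** The mean is written through the integrals of 1, of the positive part and of the negative part
    over the ball, nonnegative functions to which the previous openness applies. For centres in [E]
    the measure of the ball is positive and finite, so that the division is an honest one. *)
Lemma measurable_mean (u : X -> \bar R) (r : R) :
  measurable (E : set (g_sigma_algebraType Gnu)) -> (0 < r <= r0)%R ->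
  Lploc mu 1 u ->
  measurable_fun (E : set (g_sigma_algebraType Gnu)) (fun x => mean mu (ball x r) u).
Proof.
move=> mE rr locu.
have [r_gt0 _] := andP rr.
have mu_u x : measurable_fun (ball x r : set (g_sigma_algebraType Gmu)) u.
  by have [] := locu x r r_gt0.
have iu x : mu.-integrable (ball x r) u.
  apply/integrableP; split => //; have [_] := locu x r r_gt0.
  by under eq_integral do rewrite poweRe1//.
pose m x := fine (\int[mu]_(y in ball x r) (cst 1%E y)).
pose P x := fine (\int[mu]_(y in ball x r) u^\+ y).
pose Q x := fine (\int[mu]_(y in ball x r) u^\- y).
have mfine (f : X -> \bar R) :
    measurable_fun (setT : set (g_sigma_algebraType Gnu)) f ->
    measurable_fun (E : set (g_sigma_algebraType Gnu)) (fine \o f).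
  move=> mf; apply: (measurable_funS (measurableT) (@subsetT _ _)).
  exact: measurableT_comp.
apply: (eq_measurable_fun (fun x : g_sigma_algebraType Gnu =>
    (m x `^ (-1) * (P x - Q x))%:E)).
  move=> x /set_mem Ex.
  rewrite EFinM EFinB /P /Q !fineK; last 2 first.
  - exact: integrable_neg_fin_num.
  - exact: integrable_pos_fin_num.
  rewrite /mean -integralE; congr (_ * _).
  have m_gt0 : (0 < fine (mu (ball x r)))%R by exact: (mu_ball_fine_gt0 C0 dmu).
  rewrite /m integral_cst//= mul1e powR_inv1 ?(ltW m_gt0)//.
  rewrite -[in RHS](fineK (mu_ball_fin C0 dmu Ex rr)) inver gt_eqF//.
apply/measurable_EFinP; apply: measurable_funM.
  apply: (measurableT_comp (measurable_powR _)); apply: mfine.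
  by apply: measurable_ball_integral.
by apply: measurable_funB; apply: mfine; apply: measurable_ball_integral => //;
  move=> x; [exact: measurable_funepos|exact: measurable_funeneg].
Qed.

Lemma Lebesgue_values_dyadic (u : X -> \bar R) (x : X) (a : R) : (0 < a)%R ->
  Lebesgue_values mu u x ->
  mean mu (ball x (a / 2 ^+ i)) u @[i --> \oo] --> u x.
Proof.
move=> a0 ux.
have a2 : (a / 2 ^+ i @[i --> \oo] --> (0 : R))%R.
  have -> : (fun i => a / 2 ^+ i)%R = geometric a (2^-1)%R.
    by apply/funext => i /=; rewrite exprVn.
  by apply: cvg_geometric; rewrite ger0_norm ?invr_ge0// invf_lt1// ltr1n.
have a2r : (a / 2 ^+ i)%R @[i --> \oo] --> (0 : R)^'+.
  move=> P P0.
  have aP : \forall i \near \oo, (0 < a / 2 ^+ i)%R -> P (a / 2 ^+ i)%R := a2 _ P0.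
  by apply: filterS aP => i; apply; rewrite divr_gt0// exprn_gt0.
exact: cvg_comp a2r ux.
Qed.

(** The measurability assumed of [u] refers to [mu]. Off a [nu]-null set [u] is a limit of means
    that are [nu]-measurable on [E], and completeness of [nu] absorbs the null set. *)
Lemma measurable_Lebesgue (u : X -> \bar R) :
  measurable (E : set (g_sigma_algebraType Gnu)) -> Lploc mu 1 u ->
  {ae nu, forall x, E x -> Lebesgue_values mu u x} ->
  measurable_fun (E : set (g_sigma_algebraType Gnu)) u.
Proof.
move=> mE locu [N [mN N0 NP]] _ B mBB.
have mEN : measurable (E `\` N : set (g_sigma_algebraType Gnu)) by exact: measurableD.
have rn0 i : (0 < r0 / 2 ^+ i <= r0)%R.
  rewrite divr_gt0 ?exprn_gt0//= ler_pdivrMr ?exprn_gt0//.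
  by rewrite ler_peMr ?(ltW r00)// exprn_ege1// ler1n.
have muEN : measurable_fun (E `\` N : set (g_sigma_algebraType Gnu)) u.
  apply: (emeasurable_fun_cvg (fun i (x : g_sigma_algebraType Gnu) =>
    mean mu (ball x (r0 / 2 ^+ i)) u)).
    move=> i; apply: (measurable_funS mE (@subDsetl _ _ _)).
    exact: measurable_mean.
  move=> x [Ex Nx]; apply: Lebesgue_values_dyadic => //.
  apply: contrapT => nL; apply: Nx; apply: NP => /=.
  by move=> /(_ Ex).
rewrite (_ : _ `&` _ = ((E `\` N) `&` u @^-1` B) `|` (E `&` N `&` u @^-1` B)).
  apply: measurableU; first exact: muEN.
  by apply: (bnu.2); exists N; split => // x [[]].
apply/seteqP; split => x /=.
  by move=> [Ex Bx]; have [Nx|Nx] := pselect (N x); [right|left].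
by move=> [[[]]|[[]]].
Qed.

End measurability.

Lemma diam_ball_le {R : realType} {X : pmetricType R} (x : X) (r : R) :
  diam (ball x r) <= (2 * r)%:E.
Proof.
apply: ge_ereal_sup => _ [[y z] /= [xy xz] <-]; rewrite lee_fin.
move: xy xz; rewrite !ballEmdist/= => xy xz.
rewrite (le_trans (metric_triangle _ x _))// [mdist y x]metric_sym.
by rewrite mulrDl mul1r lerD// ltW.
Qed.

Lemma diam_ge0 {R : realType} {X : pmetricType R} (A : set X) :
  A !=set0 -> 0 <= diam A.
Proof.
by move=> [x Ax]; apply: ereal_sup_ubound; exists (x, x) => //=; rewrite mdistxx.
Qed.

(** * Chaining, the weak type estimate and truncation *)

Section chaining.
Context {R : realType} {X : pmetricType R} {Gmu Gnu : set (set X)}.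
Variables (mu : {measure set (g_sigma_algebraType Gmu) -> \bar R})
  (nu : {measure set (g_sigma_algebraType Gnu) -> \bar R}).
Variables (E : set X) (r0 p q alpha lam delta C CP : R).
Hypotheses (bmu : complete_Borel mu) (bnu : complete_Borel nu).
Hypotheses (p1 : (1 <= p)%R) (pq : (p < q)%R) (al0 : (0 < alpha)%R).
Hypotheses (lam1 : (1 <= lam)%R) (de0 : (0 < delta)%R).
Hypotheses (C0 : (0 < C)%R) (CP0 : (0 < CP)%R).
Hypotheses (dmu : doubling_on mu E r0 C) (dnu : doubling_on nu E r0 C).
Hypothesis rdnu : reverse_doubling_on nu E r0 C delta.
Variables (x0 : X) (r theta : R).
Hypotheses (Ex0 : E x0) (r_gt0 : (0 < r)%R) (rr0 : (10 * lam * r <= r0)%R).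
Hypotheses (th0 : (0 <= theta)%R)
  (thP : forall x rho, E x -> (0 < rho <= r)%R ->
    (rho `^ alpha * fine (nu (ball x rho)) `^ q^-1 <=
     theta * fine (mu (ball x (lam * rho))) `^ p^-1)%R).

Let p0 : (0 < p)%R. Proof. exact: lt_le_trans p1. Qed.
Let q0 : (0 < q)%R. Proof. exact: lt_trans pq. Qed.
Let lam0 : (0 < lam)%R. Proof. exact: lt_le_trans lam1. Qed.

Local Notation I h A := (\int[mu]_(y in A) (h y `^ p)).

(** * Chaining along dyadic balls *)

Let nball (x : X) (rho : R) : R := fine (nu (ball x rho)).
Let mball (x : X) (rho : R) : R := fine (mu (ball x rho)).

(** [theta] controls radii up to r only, while t rho may exceed r (t = 2 in the first step of the
    chain). The ratio is therefore taken at rho; passing from mu of the ball of radius [lam * rho]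
    to the larger one in the denominator goes in the right direction. The diameter accounts for (2
    t)^alpha. *)
Lemma poincare_theta (v h : X -> \bar R) (x : X) (rho t : R) :
  Poincare mu E r0 alpha p lam CP v h -> (forall y, 0 <= h y) ->
  E x -> (0 < rho <= r)%R -> (1 <= t)%R -> (lam * (t * rho) <= r0)%R ->
  I h (ball x (lam * (t * rho))) < +oo ->
  mean mu (ball x (t * rho)) (fun y => `|v y - mean mu (ball x (t * rho)) v|) <=
  (CP * (2 * t) `^ alpha * theta * (nball x rho `^ (- q^-1) *
   fine (I h (ball x (lam * (t * rho)))) `^ p^-1))%:E.
Proof.
move=> PI h0 Ex /andP[rho0 rhor] t1 ltr Ioo.
have t0 : (0 < t)%R by exact: lt_le_trans t1.
have trho0 : (0 < t * rho)%R by rewrite mulr_gt0.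
have ltrho0 : (0 < lam * (t * rho))%R by rewrite mulr_gt0.
have trr : (t * rho <= r0)%R by rewrite (le_trans _ ltr)// ler_peMl// ltW.
have lrr : (0 < lam * rho <= r0)%R.
  by rewrite mulr_gt0//= (le_trans _ ltr)// ler_pM2l// ler_peMl// ltW.
have rhor0 : (0 < rho <= r0)%R by rewrite rho0 (le_trans _ trr)// ler_peMl// ltW.
have mL : (0 < mball x (lam * (t * rho)))%R.
  by apply: (mu_ball_fine_gt0 C0 dmu); rewrite ?ltrho0.
have ml : (0 < mball x (lam * rho))%R by exact: (mu_ball_fine_gt0 C0 dmu).
have mn : (0 < nball x rho)%R by exact: (mu_ball_fine_gt0 C0 dnu).
have Ige0 : 0 <= I h (ball x (lam * (t * rho))).
  by apply: integral_ge0 => y _; exact: poweR_ge0.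
have If : I h (ball x (lam * (t * rho))) \is a fin_num by rewrite ge0_fin_numE.
apply: le_trans (PI _ _ Ex _) _; first by rewrite trho0.
rewrite /mean -(fineK If) -(@fineK _ (mu _)); last first.
  by apply: (mu_ball_fin C0 dmu); rewrite ?ltrho0.
rewrite inver gt_eqF// -EFinM poweR_EFin.
set J := fine (I h _); have J0 : (0 <= J)%R by rewrite fine_ge0.
apply: (@le_trans _ _ (CP%:E * ((2 * (t * rho))%:E `^ alpha) *
    (((fine (mu (ball x (lam * (t * rho)))))^-1 * J) `^ p^-1)%:E)).
  rewrite lee_wpmul2r ?lee_fin ?powR_ge0// lee_wpmul2l ?lee_fin ?(ltW CP0)//.
  have dge0 : 0 <= diam (ball x (t * rho)).
    by apply: diam_ge0; exists x; exact: ballxx.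
  rewrite gt0_ler_poweR ?(ltW al0)//; last exact: diam_ball_le.
    by rewrite in_itv/= dge0 leey.
  by rewrite in_itv/= lee_fin leey andbT mulr_ge0// ltW.
rewrite poweR_EFin -!EFinM lee_fin (mulrA 2%R) powRM ?mulr_ge0 ?(ltW t0) ?(ltW rho0)//.
rewrite [((_ * J) `^ _)%R]powRM ?invr_ge0 ?(ltW mL)//.
rewrite -(powR_inv1 (ltW mL)) -powRrM mulN1r !powRN.
have key : (rho `^ alpha / mball x (lam * (t * rho)) `^ p^-1 <=
    theta / nball x rho `^ q^-1)%R.
  rewrite ler_pdivrMr ?powR_gt0// mulrAC ler_pdivlMr ?powR_gt0//.
  apply: le_trans (thP Ex _) _; first by rewrite rho0.
  rewrite ler_wpM2l// ler_powR2l// ?invr_ge0 ?(ltW p0) ?(ltW ml)//.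
  apply: fine_le.
  - exact: (mu_ball_fin C0 dmu).
  - by apply: (mu_ball_fin C0 dmu); rewrite ?ltrho0.
  - apply: (le_mu_ball bmu); first exact: (measurable_ball _ _ bmu).
    by apply: le_ball; rewrite ler_pM2l// ler_peMl// ltW.
have c0 : (0 <= CP * (2 * t) `^ alpha * J `^ p^-1)%R.
  by rewrite !mulr_ge0 ?powR_ge0// ltW.
by have := ler_wpM2l c0 key; congr (_ <= _)%R; rewrite /mball /nball; ring.
Qed.

Let U (v : X -> \bar R) (x : X) (rho : R) : R := fine (mean mu (ball x rho) v).

Let M (v : X -> \bar R) (x : X) (rho : R) : \bar R :=
  mean mu (ball x rho) (fun y => `|v y - mean mu (ball x rho) v|).

Let r_le_r0 : (r <= r0)%R.
Proof.
rewrite (le_trans _ rr0)// ler_peMl ?(ltW r_gt0)// -[leLHS]mulr1 ler_pM ?ler1n//.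
Qed.

Let lr_le_r0 (c : R) : (0 <= c <= 10)%R -> (c * lam * r <= r0)%R.
Proof.
move=> /andP[c0 c10]; rewrite (le_trans _ rr0)// -!mulrA ler_wpM2r//.
by rewrite mulr_ge0 ?ltW.
Qed.

Lemma mean_fineK (v : X -> \bar R) (x : X) (rho : R) : E x -> (0 < rho <= r0)%R ->
  mu.-integrable (ball x rho) v -> (U v x rho)%:E = mean mu (ball x rho) v.
Proof.
move=> Ex rhor iv; rewrite fineK// mean_fin_num//.
  exact: (measurable_ball _ _ bmu).
exact: (mu_ball_gt0 dmu).
Qed.

Lemma mean_diff (v : X -> \bar R) (x : X) (rho : R) (y : X) (sigma c b : R) :
  E x -> (0 < rho <= r0)%R -> E y -> (0 < sigma <= r0)%R ->
  mu.-integrable (ball y sigma) v -> ball x rho `<=` ball y sigma ->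
  mu (ball y sigma) <= c%:E * mu (ball x rho) -> (0 <= c)%R ->
  M v y sigma <= b%:E -> (`|U v x rho - U v y sigma| <= c * b)%R.
Proof.
move=> Ex rhor Ey sr iv sub muc c0 Mb.
have mx : measurable (ball x rho : set (g_sigma_algebraType Gmu)).
  exact: (measurable_ball _ _ bmu).
have my : measurable (ball y sigma : set (g_sigma_algebraType Gmu)).
  exact: (measurable_ball _ _ bmu).
have ivx : mu.-integrable (ball x rho) v by exact: integrableS iv.
rewrite -lee_fin EFinM -abse_EFin EFinB mean_fineK//.
have muoo : mu (ball y sigma) < +oo by rewrite ltey_eq (mu_ball_fin C0 dmu).
have := mean_subset_dist (U v y sigma) mx my sub (mu_ball_gt0 dmu Ex rhor) muoo muc iv.
move=> /le_trans; apply; rewrite lee_wpmul2l ?lee_fin// (le_trans _ Mb)//.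
by rewrite /M (mean_fineK Ey).
Qed.

(** The first summand belongs to a halving step. In the second, C^2 and C compare B(x, r) and B(x0,
    r) with B(x0, 2r), and C^(1/q) replaces nu(B(x0, r)) by nu(B(x, r)). *)
Definition chain_cst : R :=
  (C * CP * 2 `^ alpha + (C ^+ 2 + C) * CP * 4 `^ alpha * C `^ q^-1)%R.

(** What the estimates on the fixed ball B(x0, r) ask of a pair, chosen so that it passes from
    [(u, g)] to truncated pairs. *)
Definition admissible (v h : X -> \bar R) : Prop :=
  [/\ forall x rho, E x -> (0 < rho <= r0)%R -> mu.-integrable (ball x rho) v,
      forall y, 0 <= h y,
      measurable_fun (ball x0 (2 * lam * r) : set (g_sigma_algebraType Gmu)) h,
      I h (ball x0 (2 * lam * r)) < +oo
    & Poincare mu E r0 alpha p lam CP v h].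

Let G (h : X -> \bar R) : R := fine (I h (ball x0 (2 * lam * r))).

Let rho_gt0 i : (0 < r / 2 ^+ i)%R.
Proof. by rewrite divr_gt0// exprn_gt0. Qed.

Let rho_le_r i : (r / 2 ^+ i <= r)%R.
Proof.
by rewrite ler_pdivrMr ?exprn_gt0// ler_peMr ?(ltW r_gt0)// exprn_ege1 ?ler1n.
Qed.

Let rho_r0 i : (0 < r / 2 ^+ i <= r0)%R.
Proof. by rewrite rho_gt0 (le_trans (rho_le_r i)). Qed.

Let measurable_pow (A : set X) (h : X -> \bar R) :
  measurable_fun (A : set (g_sigma_algebraType Gmu)) h ->
  measurable_fun (A : set (g_sigma_algebraType Gmu)) (fun y => h y `^ p).
Proof. by move=> mh; exact: (measurableT_comp (measurable_poweR _)). Qed.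

Lemma integral_pow_ball_le (v h : X -> \bar R) (x : X) (rho : R) : admissible v h ->
  ball x rho `<=` ball x0 (2 * lam * r) ->
  (I h (ball x rho) < +oo) /\ (fine (I h (ball x rho)) <= G h)%R.
Proof.
move=> [_ h0 mh Ioo _] sub.
have Ile : I h (ball x rho) <= I h (ball x0 (2 * lam * r)).
  apply: ge0_subset_integral => //; try exact: (measurable_ball _ _ bmu).
    exact: measurable_pow.
  by move=> y _; exact: poweR_ge0.
have Ioo' := le_lt_trans Ile Ioo.
split => //; apply: fine_le => //; rewrite ge0_fin_numE//;
  by apply: integral_ge0 => y _; exact: poweR_ge0.
Qed.

Lemma ball_lam_sub x i : ball x0 r x ->
  ball x (lam * (r / 2 ^+ i)) `<=` ball x0 (2 * lam * r).
Proof.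
move=> xx0; apply: (ball_subD xx0).
rewrite -mulrA mulrDl mul1r lerD//; first by rewrite ler_peMl// ltW.
by rewrite ler_pM2l.
Qed.

Lemma chain_step (v h : X -> \bar R) (x : X) (i : nat) : admissible v h ->
  E x -> ball x0 r x ->
  (`|U v x (r / 2 ^+ i.+1) - U v x (r / 2 ^+ i)| <= C * (CP * 2 `^ alpha * theta *
    (fine (I h (ball x (lam * (r / 2 ^+ i)))) `^ p^-1 *
     nball x (r / 2 ^+ i) `^ (- q^-1))))%R.
Proof.
move=> adm Ex xx0; have [iv h0 mh Ioo PI] := adm.
have rE : (r / 2 ^+ i = 2 * (r / 2 ^+ i.+1))%R.
  by rewrite exprS; field; rewrite expf_neq0.
apply: mean_diff => //; rewrite ?rho_r0//.
- exact: iv.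
- by apply: le_ball; rewrite rE ler_peMl ?ler1n// ltW.
- by rewrite rE; have [] := dmu Ex (rho_r0 i.+1).
- exact: ltW.
have [Ixoo _] := integral_pow_ball_le adm (@ball_lam_sub x i xx0).
have := @poincare_theta v h x (r / 2 ^+ i)%R 1 PI h0 Ex.
rewrite rho_gt0 rho_le_r !mul1r mulr1 [(fine _ `^ _ * _)%R]mulrC; apply => //.
rewrite (le_trans _ (lr_le_r0 (c := 1%R) _))// ?mul1r ?ler_pM2l//.
by rewrite ler01 ler1n.
Qed.

(* The ball of radius [r] centred at [x] need not meet the one centred at [x0] in a
   set of comparable measure: both are compared with the ball of radius [2 * r]. *)
Lemma chain_first (v h : X -> \bar R) (x : X) : admissible v h -> E x -> ball x0 r x ->
  (`|U v x r - U v x0 r| <= (C ^+ 2 + C) * (CP * 4 `^ alpha * theta *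
    (C `^ q^-1 * (G h `^ p^-1 * nball x r `^ (- q^-1)))))%R.
Proof.
move=> adm Ex xx0; have [iv h0 mh Ioo PI] := adm.
have r2 : (0 < 2 * r <= r0)%R.
  rewrite mulr_gt0//= (le_trans _ (lr_le_r0 (c := 2%R) _))//; last first.
    by rewrite ler0n ler_nat.
  by rewrite ler_pM2r// ler_peMr.
have rr : (0 < r <= r0)%R by rewrite r_gt0.
have lr2 : (lam * (2 * r) = 2 * lam * r)%R by ring.
set b := (CP * 4 `^ alpha * theta * _)%R.
have Mb : M v x0 (2 * r) <= b%:E.
  apply: le_trans (@poincare_theta v h x0 r 2 PI h0 Ex0 _ _ _ _) _.
  - by rewrite r_gt0 lexx.
  - by rewrite ler1n.
  - by rewrite lr2 lr_le_r0// ler0n ler_nat.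
  - by rewrite lr2.
  rewrite lr2 lee_fin /b -natrM -/(G h).
  rewrite ler_wpM2l ?mulr_ge0 ?powR_ge0 ?(ltW CP0)//.
  rewrite [leLHS]mulrC mulrCA ler_wpM2l ?powR_ge0// !powRN.
  have nx : (0 < nball x r)%R by exact: (mu_ball_fine_gt0 C0 dnu).
  have nx0 : (0 < nball x0 r)%R by exact: (mu_ball_fine_gt0 C0 dnu).
  rewrite ler_pdivlMr ?powR_gt0// mulrC ler_pdivrMr ?powR_gt0//.
  rewrite -powRM ?(ltW C0) ?(ltW nx0)// ler_powR2l ?invr_ge0 ?(ltW q0) ?(ltW nx)//.
  have nf x' : E x' -> nu (ball x' r) \is a fin_num.
    by move=> Ex'; exact: (mu_ball_fin C0 dnu).
  rewrite -lee_fin EFinM !fineK ?nf//.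
  have [_ + _] := dnu Ex0 rr; apply: le_trans.
  apply: (le_mu_ball bnu); first exact: (measurable_ball _ _ bnu).
  by apply: (ball_subD xx0); rewrite mulrDl !mul1r.
rewrite mulrDl (le_trans (ler_distD (U v x0 (2 * r)) _ _))// lerD//.
- apply: mean_diff => //.
  + exact: iv.
  + by apply: (ball_subD xx0); rewrite mulrDl !mul1r.
  + apply: (@le_trans _ _ (mu (ball x (2 ^+ 2 * r)))).
      apply: (le_mu_ball bmu); first exact: (measurable_ball _ _ bmu).
      apply: (ball_subD (ball_sym xx0)).
      by rewrite expr2 -mulrA [leRHS]mulrDl !mul1r lerD2r ler_peMl ?ler1n// ltW.
    apply: (mu_ball_doubling C0 dmu) => //.
    by rewrite expr2 -mulrA ler_pM2l//; case/andP: r2.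
  + by rewrite exprn_ge0// ltW.
rewrite distrC; apply: mean_diff => //.
- exact: iv.
- by apply: le_ball; rewrite ler_peMl ?ler1n// ltW.
- by have [] := dmu Ex0 rr.
- exact: ltW.
Qed.

Lemma nball_decay (x : X) (j k : nat) : E x -> (j <= k)%N ->
  (nball x (r / 2 ^+ k) <= C * (2^-1 `^ delta) ^+ (k - j) * nball x (r / 2 ^+ j))%R.
Proof.
move=> Ex jk.
have nx i : (0 < nball x (r / 2 ^+ i))%R by exact: (mu_ball_fine_gt0 C0 dnu).
have C1 : (1 <= C)%R.
  by apply: (doubling_cst_ge1 bnu C0 dnu Ex); rewrite (lt_le_trans r_gt0).
(* Reverse doubling compares distinct radii; for equal ones the claim rests on C >= 1. *)
have [->|jk'] := eqVneq j k.
  by rewrite subnn expr0 mulr1 ler_peMl// ltW.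
have {}jk : (j < k)%N by rewrite ltn_neqAle jk'.
rewrite -ler_pdivrMr// -lee_fin.
have nf l : nu (ball x (r / 2 ^+ l)) \is a fin_num.
  exact: (mu_ball_fin C0 dnu).
have kj : ((r / 2 ^+ k) / (r / 2 ^+ j) = 2^-1 ^+ (k - j) :> R)%R.
  rewrite -(subnK (ltnW jk)) addnK exprD exprVn; field.
  by rewrite !expf_neq0//= gt_eqF.
have kr : (r / 2 ^+ k < r / 2 ^+ j)%R.
  by rewrite ltr_pM2l// ltf_pV2 ?posrE ?exprn_gt0// ltr_eXn2l// ltr1n.
have jr : (r / 2 ^+ j <= r0)%R by have /andP[] := rho_r0 j.
have := rdnu Ex (rho_gt0 k) kr jr.
by rewrite kj powRX ?invr_ge0// -(fineK (nf k)) -(fineK (nf j)) inver gt_eqF// nx.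
Qed.

(** The halving steps fall under [hedberg_sum]. The first step involves the full integral G over 2
    lam B and is bounded separately: G^(1/p) nu^(-1/q) = G^(1/p - 1/q) (G / nu)^(1/q), with G / nu
    <= s by assumption. *)
Lemma hedberg_pointwise (v h : X -> \bar R) (x : X) (s : R) (i : nat) :
  admissible v h -> E x -> ball x0 r x -> (0 < s)%R -> (G h <= s * nball x r)%R ->
  (forall j, fine (I h (ball x (lam * (r / 2 ^+ j)))) <= s * nball x (r / 2 ^+ j))%R ->
  (`|U v x (r / 2 ^+ i) - U v x0 r| <=
   chain_cst * (hedberg_cst p q C (2^-1 `^ delta) + 1) * theta *
   (G h `^ (p^-1 - q^-1) * s `^ q^-1))%R.
Proof.
move=> adm Ex xx0 s0 Gs Is.
have nx j : (0 < nball x (r / 2 ^+ j))%R by exact: (mu_ball_fine_gt0 C0 dnu).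
pose a j := (fine (I h (ball x (lam * (r / 2 ^+ j)))) `^ p^-1 *
             nball x (r / 2 ^+ j) `^ (- q^-1))%R.
have G0 : (0 <= G h)%R.
  by apply: fine_ge0; apply: integral_ge0 => y _; exact: poweR_ge0.
set Z := (G h `^ (p^-1 - q^-1) * s `^ q^-1)%R.
have Z0 : (0 <= Z)%R by rewrite mulr_ge0 ?powR_ge0.
have first_le : (G h `^ p^-1 * nball x r `^ (- q^-1) <= Z)%R.
  have nxr : (0 < nball x r)%R by have := nx 0%N; rewrite expr0 divr1.
  rewrite powRN ler_pdivrMr ?powR_gt0// -mulrA -powRM ?(ltW s0) ?(ltW nxr)//.
  apply: (@le_trans _ _ (G h `^ (p^-1 - q^-1) * G h `^ q^-1)%R).
    by rewrite -powRD ?subrK// invr_eq0 gt_eqF.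
  by rewrite ler_wpM2l ?powR_ge0// ler_powR2l// invr_ge0 ltW.
have th01 : (0 < (2^-1 : R) `^ delta < 1)%R.
  by apply: powR_lt1 => //; rewrite invr_gt0 ltr0n invf_lt1// ltr1n.
have sum_le : (\sum_(j < i) a j <= hedberg_cst p q C (2^-1 `^ delta) * Z)%R.
  apply: (@hedberg_sum _ _ _ _ _ s (G h)
    (fun j => fine (I h (ball x (lam * (r / 2 ^+ j)))))
    (fun j => nball x (r / 2 ^+ j))) => //.
  - by rewrite p0.
  - by move=> j k jk; exact: nball_decay.
  - move=> j; have [_ ->] := integral_pow_ball_le adm (@ball_lam_sub x j xx0).
    by rewrite fine_ge0//; apply: integral_ge0 => y _; exact: poweR_ge0.
have tele : (`|U v x (r / 2 ^+ i) - U v x r| <=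
    C * CP * 2 `^ alpha * theta * \sum_(j < i) a j)%R.
  elim: i {sum_le} => [|i ih]; first by rewrite expr0 divr1 subrr normr0 big_ord0 mulr0.
  rewrite (le_trans (ler_distD (U v x (r / 2 ^+ i)) _ _))// addrC.
  rewrite big_ord_recr/= mulrDr lerD//.
  by apply: le_trans (chain_step i adm Ex xx0) _; rewrite !mulrA.
rewrite (le_trans (ler_distD (U v x r) _ _))//.
have K1 : (0 <= C * CP * 2 `^ alpha)%R by rewrite !mulr_ge0 ?powR_ge0 ?ltW.
have K2 : (0 <= (C ^+ 2 + C) * CP * 4 `^ alpha * C `^ q^-1)%R.
  by rewrite !mulr_ge0 ?powR_ge0 ?addr_ge0 ?exprn_ge0 ?ltW.
have Kh : (0 <= hedberg_cst p q C (2^-1 `^ delta))%R.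
  by apply: hedberg_cst_ge0 => //; rewrite p0.
apply: (@le_trans _ _ (C * CP * 2 `^ alpha * theta *
     (hedberg_cst p q C (2^-1 `^ delta) * Z) +
   ((C ^+ 2 + C) * CP * 4 `^ alpha * C `^ q^-1) * theta * Z)%R).
  apply: lerD.
    by apply: le_trans tele _; rewrite ler_wpM2l// mulr_ge0.
  apply: le_trans (chain_first adm Ex xx0) _.
  rewrite [leLHS](_ : _ = (C ^+ 2 + C) * CP * 4 `^ alpha * C `^ q^-1 * theta *
    (G h `^ p^-1 * nball x r `^ (- q^-1)))%R; last by ring.
  by rewrite ler_wpM2l// mulr_ge0.
rewrite /chain_cst; set k1 := (C * CP * _)%R in K1 *.
set k2 := (_ * C `^ q^-1)%R in K2 *; set kh := hedberg_cst _ _ _ _ in Kh *.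
(* (k1 + k2)(kh + 1) exceeds the required k1 kh + k2 by k1 + k2 kh: the [+ 1] in the constant pays
   for the first step. *)
rewrite -subr_ge0 (_ : _ - _ = (k1 + k2 * kh) * theta * Z)%R; last by ring.
apply: mulr_ge0 => //; apply: mulr_ge0 => //.
by apply: addr_ge0 => //; exact: mulr_ge0.
Qed.

(** * The weak type estimate *)

Variable k : nat.
Hypothesis hk : (2 ^+ k < 2 * lam <= 2 ^+ k.+1)%R.

Let measurable_B (x : X) (rho : R) :
  measurable (ball x rho : set (g_sigma_algebraType Gmu)).
Proof. exact: (measurable_ball _ _ bmu). Qed.

Let measurable_Bnu (x : X) (rho : R) :
  measurable (ball x rho : set (g_sigma_algebraType Gnu)).
Proof. exact: (measurable_ball _ _ bnu). Qed.

Let nball_gt0 (x : X) i : E x -> (0 < nball x (r / 2 ^+ i))%R.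
Proof. by move=> Ex; exact: (mu_ball_fine_gt0 C0 dnu). Qed.

Let nball_fin (x : X) i : E x -> nu (ball x (r / 2 ^+ i)) \is a fin_num.
Proof. by move=> Ex; exact: (mu_ball_fin C0 dnu). Qed.

Let G_ge0 (h : X -> \bar R) : (0 <= G h)%R.
Proof. by apply: fine_ge0; apply: integral_ge0 => y _; exact: poweR_ge0. Qed.

Let GK v h : admissible v h -> I h (ball x0 (2 * lam * r)) = (G h)%:E.
Proof.
move=> [_ _ _ Ioo _]; rewrite fineK// ge0_fin_numE//.
by apply: integral_ge0 => y _; exact: poweR_ge0.
Qed.

(** The second condition bounds a dyadic maximal function, normalised by [nu]; the first serves the
    step through 2B, whose Poincare inequality sees the whole integral over 2 lam B. *)
Definition maximal_le (h : X -> \bar R) (s : R) (x : X) : Prop :=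
  (G h <= s * nball x r)%R /\
  forall j, (fine (I h (ball x (lam * (r / 2 ^+ j)))) <=
             s * nball x (r / 2 ^+ j))%R.

Definition covering_cst : R := (C ^+ k.+1 + C)%R.

(** If the first condition of [maximal_le] fails at some x, then nu(B(x0, r)) <= C nu(B(x, r)) < C G
    / s, and all of B(x0, r) can go into [W]; this is the summand C of [covering_cst]. Otherwise
    only the second condition can fail, and the covering deals with it. *)
Lemma maximal_le_weak v h (s : R) : admissible v h -> (0 < s)%R ->
  exists W : set X, [/\ measurable (W : set (g_sigma_algebraType Gnu)),
    forall x, E x -> ball x0 r x -> ~ W x -> maximal_le h s x
    & nu W <= (covering_cst * G h / s)%:E].
Proof.
move=> adm s0; have [iv h0 mh Ioo PI] := adm.
have lr2 : (2 * lam * r <= r0)%R by rewrite lr_le_r0// ler0n ler_nat.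
have [W1 [mW1 W1P nW1]] := maximal_weak_type bmu bnu C0 dnu Ex0 r_gt0 lam1 lr2 hk s0
  (measurable_pow mh) (fun x => poweR_ge0 _ _).
have [[x [Ex xx0 xG]]|noW2] :=
    pselect (exists x, [/\ E x, ball x0 r x & (s * nball x r < G h)%R]).
- exists (W1 `|` ball x0 r); split; first exact: measurableU.
    by move=> y Ey yy0 nW; exfalso; apply: nW; right.
  apply: (@le_trans _ _ (nu W1 + nu (ball x0 r))); first exact: measureU2.
  rewrite /covering_cst 2!mulrDl EFinD leeD//.
    by rewrite (le_trans nW1)// (GK adm) -EFinM lee_fin mulrAC.
  apply: (@le_trans _ _ (C * nball x r)%:E).
    rewrite EFinM fineK; last first.
      by have := nball_fin 0 Ex; rewrite expr0 divr1.
    have [|_ + _] := dnu Ex (r := r); first by rewrite r_gt0 r_le_r0.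
    apply: le_trans; apply: (le_mu_ball bnu) => //.
    by apply: (ball_subD (ball_sym xx0)); rewrite mulrDl !mul1r.
  by rewrite lee_fin -mulrA ler_pM2l// ler_pdivlMr// mulrC ltW.
exists W1; split => //.
  move=> x Ex xx0 nW1'; split.
    by rewrite leNgt; apply/negP => xG; apply: noW2; exists x.
  move=> j; rewrite leNgt; apply/negP => xj; apply: nW1'.
  apply: W1P => //; exists j.
  have [Ixoo _] := integral_pow_ball_le adm (@ball_lam_sub x j xx0).
  rewrite -(fineK (nball_fin j Ex)) -EFinM -[ltRHS]fineK ?lte_fin//.
  by rewrite ge0_fin_numE//; apply: integral_ge0 => y _; exact: poweR_ge0.
rewrite (le_trans nW1)// (GK adm) -EFinM lee_fin mulrAC ler_pM2r ?invr_gt0//.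
by rewrite ler_wpM2r// /covering_cst lerDl ltW.
Qed.

(** The exceptional sets for s = n + 1 have arbitrarily small measure, so their intersection is
    null. The s found here is what passing dyadic limits on to truncations requires. *)
Lemma maximal_le_ae v h : admissible v h ->
  exists N : set X, [/\ measurable (N : set (g_sigma_algebraType Gnu)), nu N = 0
    & forall x, E x -> ball x0 r x -> ~ N x ->
        exists s, (0 < s)%R /\ maximal_le h s x].
Proof.
move=> adm.
have sn (n : nat) : (0 < n.+1%:R :> R)%R by rewrite ltr0n.
have /choice[W WP] : forall n : nat, exists W : set X,
    [/\ measurable (W : set (g_sigma_algebraType Gnu)),
    forall x, E x -> ball x0 r x -> ~ W x -> maximal_le h n.+1%:R x
    & nu W <= (covering_cst * G h / n.+1%:R)%:E].
  by move=> n; exact: (maximal_le_weak adm (sn n)).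
have mW n : measurable (W n : set (g_sigma_algebraType Gnu)) by have [] := WP n.
have mN : measurable (\bigcap_n W n : set (g_sigma_algebraType Gnu)).
  exact: bigcap_measurable.
exists (\bigcap_n W n); split => //.
  apply/eqP; rewrite eq_le measure_ge0 andbT.
  apply/lee_addgt0Pr => e e0; rewrite add0e.
  have cG : (0 <= covering_cst * G h)%R.
    by rewrite mulr_ge0// /covering_cst addr_ge0 ?exprn_ge0 ?ltW.
  have [n ne] : exists n : nat, (covering_cst * G h / n.+1%:R <= e)%R.
    exists (Num.bound (covering_cst * G h / e)).
    rewrite ler_pdivrMr// [leRHS]mulrC -ler_pdivrMr//.
    have ce : (0 <= covering_cst * G h / e)%R by rewrite divr_ge0// ltW.
    rewrite (le_trans (ltW (archi_boundP ce)))//.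
    by rewrite ler_nat.
  have [_ _ nW] := WP n.
  apply: (@le_trans _ _ (nu (W n))).
    by apply: le_measure; rewrite ?inE//; exact: bigcap_inf.
  by rewrite (le_trans nW)// lee_fin.
move=> x Ex xx0 /existsNP[n /not_implyP[_ nW]].
by exists n.+1%:R; split => //; have [_ + _] := WP n; apply.
Qed.

Definition weak_cst : R :=
  (chain_cst * (hedberg_cst p q C (2^-1 `^ delta) + 1) * covering_cst `^ q^-1)%R.

(** Only the radii of the chain appear: this is all the pointwise estimate needs, and it is the form
    of the Lebesgue value condition that is shown to survive truncation. *)
Definition dyadic_limit (v : X -> \bar R) (x : X) : Prop :=
  mean mu (ball x (r / 2 ^+ i)) v @[i --> \oo] --> v x.

Lemma dyadic_limit_dist_le (v h : X -> \bar R) (x : X) (b : R) : admissible v h -> E x ->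
  (forall i, `|U v x (r / 2 ^+ i) - U v x0 r| <= b)%R -> dyadic_limit v x ->
  `|v x - (U v x0 r)%:E| <= b%:E.
Proof.
move=> [iv _ _ _ _] Ex Ub xlim.
have UE i : mean mu (ball x (r / 2 ^+ i)) v = (U v x (r / 2 ^+ i))%:E.
  by rewrite mean_fineK//; exact: iv.
have cv : cvgn (fun i => mean mu (ball x (r / 2 ^+ i)) v).
  by apply/cvg_ex; exists (v x).
have le1 : v x <= (U v x0 r + b)%:E.
  rewrite -(cvg_lim _ xlim)//; apply: lime_le => //; apply: nearW => i.
  rewrite UE lee_fin; have := Ub i; rewrite ler_norml => /andP[_].
  by rewrite lerBlDl.
have le2 : (U v x0 r - b)%:E <= v x.
  rewrite -(cvg_lim _ xlim)//; apply: lime_ge => //; apply: nearW => i.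
  rewrite UE lee_fin; have := Ub i; rewrite ler_norml => /andP[+ _].
  by rewrite lerBrDl.
move: le1 le2; case: (v x) => [z| |]//; rewrite !lee_fin => le1 le2.
by rewrite ler_norml; apply/andP; split; rewrite ?lerBrDl// lerBlDl.
Qed.

Let theta_gt0 : (0 < theta)%R.
Proof.
rewrite lt0r th0 andbT; apply/eqP => t0; have := thP Ex0 (rho := r).
rewrite r_gt0 lexx t0 mul0r => /(_ isT); apply/negP; rewrite -ltNge.
have rr : (0 < r <= r0)%R by rewrite r_gt0.
by rewrite mulr_gt0 ?powR_gt0//; exact: (mu_ball_fine_gt0 C0 dnu).
Qed.

Let C2_gt0 : (0 < covering_cst)%R.
Proof. by rewrite addr_gt0// exprn_gt0. Qed.

Let chain_cst_gt0 : (0 < chain_cst)%R.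
Proof.
by rewrite addr_gt0 ?mulr_gt0 ?powR_gt0 ?mulr_gt0 ?addr_gt0 ?exprn_gt0.
Qed.

Let K0 : R := (chain_cst * (hedberg_cst p q C (2^-1 `^ delta) + 1))%R.

Let K0_gt0 : (0 < K0)%R.
Proof.
rewrite mulr_gt0// ltr_wpDl// hedberg_cst_ge0//; first by rewrite p0.
by apply: powR_lt1 => //; rewrite invr_gt0 ltr0n invf_lt1// ltr1n.
Qed.

Lemma weak_cst_gt0 : (0 < weak_cst)%R.
Proof. by rewrite mulr_gt0 ?powR_gt0. Qed.

Lemma weak_type v h (N : set X) (y : R) : admissible v h ->
  measurable (N : set (g_sigma_algebraType Gnu)) -> nu N = 0 ->
  (forall x, E x -> ball x0 r x -> ~ N x -> dyadic_limit v x) -> (0 < y)%R ->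
  exists W : set X, [/\ measurable (W : set (g_sigma_algebraType Gnu)),
    forall x, E x -> ball x0 r x -> ~ W x -> `|v x - (U v x0 r)%:E| <= y%:E
    & nu W <= ((weak_cst * theta * G h `^ p^-1 / y) `^ q)%:E].
Proof.
move=> adm mN N0 Nlim y0.
have KK : (0 < K0 * theta)%R by rewrite mulr_gt0.
(* For G > 0 this solves K0 theta G^(1/p - 1/q) s^(1/q) = y, turning the bound of
   [hedberg_pointwise] into y. For G = 0 that bound vanishes whatever s is, and the factor 1 keeps s
   positive. *)
pose s := ((y / (K0 * theta)) `^ q * (if G h == 0 then 1 else G h `^ (1 - q / p)))%R.
have G00 : (G h != 0 -> 0 < G h)%R by move=> G0; rewrite lt0r G0 G_ge0.
have s0 : (0 < s)%R.
  rewrite mulr_gt0 ?powR_gt0 ?divr_gt0//.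
  by case: ifPn => // /G00 ?; exact: powR_gt0.
have [W [mW WP nW]] := maximal_le_weak adm s0.
have pNq : (p^-1 - q^-1 != 0)%R by rewrite subr_eq0 gt_eqF// ltf_pV2.
exists (W `|` N); split; first exact: measurableU.
- move=> x Ex xx0 /not_orP[nWx nNx].
  have [xG xI] := WP _ Ex xx0 nWx.
  apply: (dyadic_limit_dist_le adm Ex _ (Nlim _ Ex xx0 nNx)) => i.
  apply: le_trans (hedberg_pointwise i adm Ex xx0 s0 xG xI) _.
  rewrite -/K0 /s; case: ifPn => [/eqP ->|/G00 G0].
    by rewrite powR0// mul0r mulr0 ltW.
  rewrite powRM ?powR_ge0// -!powRrM mulfV ?gt_eqF// powRr1 ?divr_ge0 ?(ltW y0) ?(ltW KK)//.
  rewrite [X in (_ * X <= _)%R]mulrCA -powRD ?(gt_eqF G0) ?implybT//.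
  rewrite (_ : _ + _ = 0)%R; last by field; rewrite !gt_eqF.
  by rewrite powRr0 mulr1 mulrC divfK// gt_eqF.
rewrite /weak_cst -/K0.
apply: (@le_trans _ _ (nu W)).
  apply: (@le_trans _ _ (nu W + nu N)); first exact: measureU2.
  by rewrite N0 adde0.
apply: le_trans nW _; rewrite lee_fin /s; case: ifPn => [/eqP ->|/G00 G0].
  by rewrite mulr0 mul0r powR_ge0.
rewrite (_ : _ / y = covering_cst `^ q^-1 * (G h `^ p^-1 * (y / (K0 * theta))^-1))%R;
  last by field; rewrite !gt_eqF.
have : (0 < y / (K0 * theta))%R by rewrite divr_gt0.
move: (y / (K0 * theta))%R => Y yK.
rewrite powRM ?powR_ge0 ?mulr_ge0 ?invr_ge0 ?(ltW yK) ?powR_ge0//.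
rewrite powRM ?powR_ge0 ?invr_ge0 ?(ltW yK)//.
rewrite -!powRrM mulVf ?gt_eqF// powRr1 ?(ltW C2_gt0)// -mulrA ler_pM2l//.
rewrite -(powR_inv1 (ltW yK)) -powRrM mulN1r powRN.
rewrite invfM mulrCA mulrC ler_pM2r ?invr_gt0 ?powR_gt0//.
rewrite ler_pdivrMr ?powR_gt0// -powRD ?(gt_eqF G0) ?implybT//.
rewrite (_ : p^-1 * q + (1 - q / p) = 1)%R; last by field; rewrite gt_eqF.
by rewrite powRr1// ltW.
Qed.

(** * Truncations and their dyadic limits *)

Definition truncr (l u z : R) : R := Num.max l (Num.min z u).

Lemma truncr_lip (l u z w : R) : (`|truncr l u z - truncr l u w| <= `|z - w|)%R.
Proof.
rewrite /truncr ler_norml.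
have := ler_norm (z - w)%R; have := lerNnormlW (lexx `|z - w|)%R.
move: `|z - w|%R => e e1 e2.
case: (leP z u) => h1; case: (leP w u) => h2.
- by case: (leP l z) => h3; case: (leP l w) => h4; apply/andP; split; lra.
- by case: (leP l z) => h3; case: (leP l u) => h4; apply/andP; split; lra.
- by case: (leP l u) => h3; case: (leP l w) => h4; apply/andP; split; lra.
- by case: (leP l u) => h3; apply/andP; split; lra.
Qed.

Lemma trunc_EFin (v : X -> \bar R) (l u z : R) (x : X) : v x = z%:E ->
  trunc v l u x = (truncr l u z)%:E.
Proof. by rewrite /trunc => ->; rewrite EFin_max EFin_min. Qed.

Lemma trunc_bound (v : X -> \bar R) (l u : R) (x : X) :
  exists t, trunc v l u x = t%:E /\ (`|t| <= `|l| + `|u|)%R.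
Proof.
have := ler_norm l; have := lerNnormlW (lexx `|l|)%R.
have := ler_norm u; have := lerNnormlW (lexx `|u|)%R.
have max_bound t : (l <= t <= Num.max l u)%R ->
    (- `|u| <= u -> u <= `|u| -> - `|l| <= l -> l <= `|l| -> `|t| <= `|l| + `|u|)%R.
  rewrite ler_norml; case: (leP l u) => h1 /andP[h2 h3] *;
  apply/andP; split; lra.
move=> h1 h2 h3 h4; case vx : (v x) => [z| |].
- exists (truncr l u z); split; first exact: trunc_EFin.
  apply: max_bound => //; rewrite /truncr.
  case: (leP z u) => hz.
    by case: (leP l z) => hl; case: (leP l u) => hu; apply/andP; split; lra.
  by case: (leP l u) => hu; apply/andP; split; lra.
- exists (Num.max l u); rewrite /trunc vx /= EFin_max; split.
    by congr maxe; rewrite /mine.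
  by apply: max_bound => //; case: (leP l u) => hl; apply/andP; split; lra.
- exists l; rewrite /trunc vx /=; split; first by rewrite minNye maxeNy.
  by apply: max_bound => //; case: (leP l u) => hl; apply/andP; split; lra.
Qed.

Lemma trunc_dist_le (v : X -> \bar R) (l u w : R) (x : X) :
  `|trunc v l u x - (truncr l u w)%:E| <= `|v x - w%:E|.
Proof.
case vx : (v x) => [z| |]; rewrite ?leey//.
by rewrite (trunc_EFin _ _ vx) lee_fin truncr_lip.
Qed.

Lemma measurable_trunc (A : set X) (v : X -> \bar R) (l u : R) :
  measurable_fun (A : set (g_sigma_algebraType Gmu)) v ->
  measurable_fun (A : set (g_sigma_algebraType Gmu)) (trunc v l u).
Proof.
by move=> mv; apply: measurable_maxe => //; exact: measurable_mine.
Qed.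

Lemma integrable_trunc (x : X) (rho : R) (v : X -> \bar R) (l u : R) :
  E x -> (0 < rho <= r0)%R -> mu.-integrable (ball x rho) v ->
  mu.-integrable (ball x rho) (trunc v l u).
Proof.
move=> Ex rhor iv.
have mv : measurable_fun (ball x rho : set (g_sigma_algebraType Gmu)) (trunc v l u).
  exact: measurable_trunc (measurable_int _ iv).
have muoo : mu (ball x rho) < +oo by rewrite ltey_eq (mu_ball_fin C0 dmu).
apply: (@le_integrable _ _ _ _ _ _ _ (cst (`|l| + `|u|)%:E)) => //.
  move=> y _ /=; have [t [-> tb]] := trunc_bound v l u y.
  by rewrite lee_fin (le_trans tb)// ler_norm.
exact: integrable_cstr.
Qed.

(* Convergence of the means of [v] alone does not pass to truncations; here the
   finite maximal function also forces the mean oscillation of [v] to vanish. *)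
Lemma dyadic_limit_trunc (v h : X -> \bar R) (l u s : R) (x : X) :
  admissible v h -> E x -> ball x0 r x -> (0 < s)%R -> maximal_le h s x ->
  dyadic_limit v x -> dyadic_limit (trunc v l u) x.
Proof.
move=> adm Ex xx0 s0 [xG xI] xlim; have [iv h0 mh Ioo PI] := adm.
have Ub i := hedberg_pointwise i adm Ex xx0 s0 xG xI.
have vfin : v x \is a fin_num.
  by have := dyadic_limit_dist_le adm Ex Ub xlim; case: (v x).
pose z := fine (v x); have vx : v x = z%:E by rewrite fineK.
have := xlim; rewrite /dyadic_limit vx => xlim_z.
pose w := trunc v l u.
have ivi i : mu.-integrable (ball x (r / 2 ^+ i)) v by exact: iv.
have iwi i : mu.-integrable (ball x (r / 2 ^+ i)) w.
  by apply: integrable_trunc => //; exact: iv.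
have Uz : (U v x (r / 2 ^+ i) @[i --> \oo] --> z)%R.
  by have /fine_cvgP[] := xlim_z.
(* The integral over lam B_i is at most s nu(B_i), which leaves nu(B_i)^(1/p - 1/q): a positive
   power, since p < q, hence geometrically small. *)
have Mle i : M v x (r / 2 ^+ i) <= (CP * 2 `^ alpha * theta *
    (s `^ p^-1 * ((C * nball x r) `^ (p^-1 - q^-1) *
     ((2^-1 `^ delta) `^ (p^-1 - q^-1)) ^+ i)))%:E.
  have [Ixoo _] := integral_pow_ball_le adm (@ball_lam_sub x i xx0).
  have := @poincare_theta v h x (r / 2 ^+ i)%R 1 PI h0 Ex.
  rewrite rho_gt0 rho_le_r !mul1r mulr1 => /(_ isT (lexx _) _ Ixoo)/le_trans; apply.
    rewrite (le_trans _ (lr_le_r0 (c := 1%R) _))// ?mul1r ?ler_pM2l//.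
    by rewrite ler01 ler1n.
  have nx0 : (0 < nball x r)%R by have := nball_gt0 0 Ex; rewrite expr0 divr1.
  have nx := nball_gt0 i Ex.
  rewrite lee_fin ler_wpM2l ?mulr_ge0 ?powR_ge0 ?(ltW CP0)// mulrC.
  have a0 : (0 <= p^-1 - q^-1)%R by rewrite subr_ge0 lef_pV2// ltW.
  apply: (@le_trans _ _ ((s * nball x (r / 2 ^+ i)) `^ p^-1 *
      nball x (r / 2 ^+ i) `^ (- q^-1))%R).
    rewrite ler_wpM2r ?powR_ge0// ler_powR2l// ?invr_ge0 ?(ltW p0)//.
    by apply: fine_ge0; apply: integral_ge0 => y _; exact: poweR_ge0.
  rewrite powRM ?(ltW s0) ?(ltW nx)// -mulrA ler_wpM2l ?powR_ge0//.
  rewrite -powRD ?(gt_eqF nx) ?implybT//.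
  rewrite -powRX ?powR_ge0// -powRM ?exprn_ge0 ?powR_ge0 ?mulr_ge0 ?(ltW C0) ?(ltW nx0)//.
  apply: ler_powR2l => //; first exact: ltW.
  by have := @nball_decay x 0 i Ex (leq0n _); rewrite subn0 expr0 divr1 mulrAC.
have M_fin i : M v x (r / 2 ^+ i) \is a fin_num.
  rewrite ge0_fin_numE; first exact: le_lt_trans (Mle i) (ltry _).
  by apply: mean_ge0 => y _; exact: abse_ge0.
(* The comparison goes through the truncated mean of [v]. As truncation is 1-Lipschitz, the first
   distance is at most the mean oscillation of [v], the second at most that of its mean from z. *)
have dist_le i : (`|U w x (r / 2 ^+ i) - truncr l u z| <=
    fine (M v x (r / 2 ^+ i)) + `|U v x (r / 2 ^+ i) - z|)%R.
  rewrite (le_trans (ler_distD (truncr l u (U v x (r / 2 ^+ i))) _ _))// lerD//.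
    have mB := measurable_B x (r / 2 ^+ i).
    have muoo : mu (ball x (r / 2 ^+ i)) < +oo by rewrite ltey_eq (mu_ball_fin C0 dmu).
    have mu0 : 0 < mu (ball x (r / 2 ^+ i)) by exact: (mu_ball_gt0 dmu).
    have := mean_subset_dist (c := 1%R) (truncr l u (U v x (r / 2 ^+ i))) mB mB
      (@subset_refl _ _) mu0 muoo _ (iwi i).
    rewrite mul1e mul1e => /(_ (lexx _)) le1.
    rewrite -lee_fin (fineK (M_fin i)); apply: le_trans (le_trans le1 _).
      by rewrite -abse_EFin EFinB mean_fineK.
    apply: le_mean => //.
    - move=> y _; rewrite abse_ge0/= -(mean_fineK Ex (rho_r0 i) (ivi i)).
      exact: trunc_dist_le.
    - exact: measurable_dist (measurable_int _ (iwi i)).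
    - rewrite -(mean_fineK Ex (rho_r0 i) (ivi i)).
      exact: measurable_dist (measurable_int _ (ivi i)).
  exact: truncr_lip.
have M0 : (fine (M v x (r / 2 ^+ i)) @[i --> \oo] --> 0)%R.
  set Kx := (CP * _ * theta)%R in Mle.
  set c := ((C * _) `^ _)%R in Mle; set t := ((_ `^ _) `^ _)%R in Mle.
  have t01 : (0 < t < 1)%R.
    apply: powR_lt1; last by rewrite subr_gt0 ltf_pV2.
    by apply: powR_lt1 => //; rewrite invr_gt0 ltr0n invf_lt1// ltr1n.
  apply: (@squeeze_cvgr _ _ _ _ (cst 0%R) (geometric (Kx * (s `^ p^-1 * c)) t)%R).
  - apply: nearW => i /=; rewrite fine_ge0/=.
      rewrite -lee_fin (fineK (M_fin i)) (le_trans (Mle i))// lee_fin.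
      by rewrite !mulrA.
    by apply: mean_ge0 => y _; exact: abse_ge0.
  - exact: cvg_cst.
  - by apply: cvg_geometric; case/andP: t01 => t0 t1; rewrite ger0_norm ?ltW.
have D0 : (fine (M v x (r / 2 ^+ i)) + `|U v x (r / 2 ^+ i) - z| @[i --> \oo] --> 0)%R.
  rewrite -[X in _ --> X](addr0 0%R); apply: cvgD => //.
  rewrite -[X in _ --> X](normr0 R) -(subrr z).
  by apply: cvg_norm; apply: cvgB => //; exact: cvg_cst.
have wlim : (U w x (r / 2 ^+ i) @[i --> \oo] --> truncr l u z)%R.
  apply/cvgrPdistC_le => e e0.
  apply: filterS (cvgr0_norm_le _ D0 _ e0) => i.
  by move=> /(le_trans (ler_norm _)); exact: le_trans.
rewrite /dyadic_limit (trunc_EFin _ _ vx).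
have -> : (fun i => mean mu (ball x (r / 2 ^+ i)) (trunc v l u)) =
    (fun i => (U w x (r / 2 ^+ i))%:E).
  by apply/funext => i; rewrite mean_fineK.
by apply: cvg_EFin => //; exact: nearW.
Qed.

(** * Integral estimates on the part of the ball in E *)

Hypothesis mE : measurable (E : set (g_sigma_algebraType Gnu)).

Let D : set (g_sigma_algebraType Gnu) := ball x0 r `&` E.

Let mD : measurable D.
Proof. exact: measurableI. Qed.

Let A (h : X -> \bar R) : R := (weak_cst * theta * G h `^ p^-1)%R.

Let A_ge0 (h : X -> \bar R) : (0 <= A h)%R.
Proof.
have w0 := ltW weak_cst_gt0.
by apply: mulr_ge0; [exact: mulr_ge0|exact: powR_ge0].
Qed.

Definition dyadic_ae (v : X -> \bar R) : Prop :=
  exists N : set X, [/\ measurable (N : set (g_sigma_algebraType Gnu)), nu N = 0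
    & forall x, E x -> ball x0 r x -> ~ N x -> dyadic_limit v x].

Lemma weak_type_measure (v h : X -> \bar R) (y : R) : admissible v h ->
  dyadic_ae v -> measurable_fun D v -> (0 < y)%R ->
  nu (D `&` [set x | y%:E < `|v x - (U v x0 r)%:E|]) <= ((A h / y) `^ q)%:E.
Proof.
move=> adm [N [mN N0 Nlim]] mv y0.
have [W [mW WP nW]] := weak_type adm mN N0 Nlim y0.
apply: le_trans nW; apply: le_measure; rewrite ?inE//.
  by apply: emeasurable_fun_o_infty => //; exact: measurable_dist.
move=> x [[xx0 Ex] /= yx]; apply: contrapT => nWx.
by have := WP _ Ex xx0 nWx; rewrite leNgt yx.
Qed.

Let D_fin : nu D \is a fin_num.
Proof.
rewrite ge0_fin_numE//; apply: (@le_lt_trans _ _ (nu (ball x0 r))).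
  by apply: le_measure; rewrite ?inE//; exact: subIsetl.
by have := nball_fin 0 Ex0; rewrite expr0 divr1 ge0_fin_numE.
Qed.

Let meanE (v h : X -> \bar R) : admissible v h ->
  mean mu (ball x0 r) v = (U v x0 r)%:E.
Proof.
have rr : (0 < r <= r0)%R by rewrite r_gt0.
by move=> [iv _ _ _ _]; rewrite mean_fineK//; exact: iv.
Qed.

Lemma null_oscillation (v : X -> \bar R) (e : R) (c : \bar R) : (0 < e)%R ->
  measurable_fun D v -> nu D = 0 -> \int[nu]_(y in D) (`|v y - c| `^ e) = 0.
Proof.
move=> e0 mv D0; apply: null_set_integral => //.
apply: (measurableT_comp (measurable_poweR _)).
by apply: measurableT_comp => //; apply: emeasurable_funB.
Qed.

Lemma poincare_lt (u g : X -> \bar R) (q' : R) : admissible u g -> dyadic_ae u ->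
  measurable_fun D u -> (1 <= q')%R -> (q' < q)%R ->
  (\int[nu]_(y in D) (`|u y - mean mu (ball x0 r) u| `^ q')) `^ q'^-1 <=
  (weak_int_cst q * A g)%:E * (nu D `^ (q'^-1 - q^-1) / (q - q')%:E).
Proof.
move=> adm ulim mu_ q'1 q'q.
have q'0 : (0 < q')%R by exact: lt_le_trans q'1.
have s0 : (0 < q - q')%R by rewrite subr_gt0.
have W0 : (0 <= weak_int_cst q * A g)%R.
  by apply: mulr_ge0 => //; apply/ltW; exact: weak_int_cst_gt0.
(* Balls centred in [E] have positive measure, but their part in [E] may be null; then the left-hand
   side vanishes. *)
have [D0|D0] := eqVneq (nu D) 0.
  rewrite null_oscillation// poweR0r ?invr_neq0 ?gt_eqF//.
  by rewrite mule_ge0// mule_ge0 ?poweR_ge0// inve_ge0 lee_fin ltW.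
pose N := fine (nu D).
have DN : nu D = N%:E by rewrite fineK.
have N0 : (0 < N)%R by rewrite -lte_fin -DN lt0e D0 measure_ge0.
rewrite (meanE adm) DN poweR_EFin inver gt_eqF// -!EFinM.
apply: weak_integral_le => //.
- exact: measurable_dist.
- by move=> y y0; exact: weak_type_measure.
Qed.

(** * Truncation between dyadic levels *)

Lemma trunc_grad_powE (u g : X -> \bar R) (l k' : R) (x : X) : (forall y, 0 <= g y) ->
  trunc_grad u g l k' x `^ p =
  ((fun y => g y `^ p) \_ [set y | (l%:E < u y < k'%:E)%E]) x.
Proof.
move=> g0; rewrite /trunc_grad patchE indicE; case: ifP => _.
  by rewrite mule1.
by rewrite mule0 poweR0r// gt_eqF.
Qed.

Let B2 : set (g_sigma_algebraType Gmu) := ball x0 (2 * lam * r).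

(** Measurability of [u] for [mu] is available on balls, so the set {l < u < k'} is cut down to
    [B2]. *)
Let band (u : X -> \bar R) (l k' : R) : set (g_sigma_algebraType Gmu) :=
  B2 `&` [set y | (l%:E < u y < k'%:E)%E].

Let measurable_band (u : X -> \bar R) (l k' : R) : measurable_fun B2 u ->
  measurable (band u l k').
Proof.
move=> mu_; have mB2 : measurable B2 by exact: measurable_B.
rewrite (_ : band _ _ _ = (B2 `&` [set y | l%:E < u y]) `&`
    (B2 `&` [set y | u y < k'%:E])).
  apply: measurableI; first exact: emeasurable_fun_o_infty.
  exact: emeasurable_fun_infty_o.
apply/seteqP; split => [y [By /= /andP[]]|y [[By /= ly] [_ /= yk]]] //.
by split => //=; rewrite ly.
Qed.

Lemma admissible_trunc (u g : X -> \bar R) (l k' : R) : admissible u g ->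
  Poincare mu E r0 alpha p lam CP (trunc u l k') (trunc_grad u g l k') ->
  admissible (trunc u l k') (trunc_grad u g l k').
Proof.
move=> [iu g0 mg Ioo _] PT.
have lr2 : (0 < 2 * lam * r <= r0)%R.
  by rewrite !mulr_gt0//= lr_le_r0// ler0n ler_nat.
have mu_ : measurable_fun B2 u by exact: measurable_int (iu _ _ Ex0 lr2).
have tg0 y : 0 <= trunc_grad u g l k' y by rewrite mule_ge0// lee_fin.
split => //.
- by move=> x rho Ex rhor; apply: integrable_trunc => //; exact: iu.
- apply: (eq_measurable_fun (fun y : g_sigma_algebraType Gmu =>
      g y * (\1_(band u l k') y)%:E)).
    move=> y /set_mem By; rewrite /trunc_grad; congr (_ * _%:E).
    by rewrite !indicE /band in_setI mem_set.
  apply: emeasurable_funM => //.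
  by apply/measurable_EFinP; apply: measurable_indic; exact: measurable_band.
- apply: le_lt_trans Ioo.
  under eq_integral do rewrite trunc_grad_powE//.
  rewrite -integral_mkcondr; apply: ge0_subset_integral => //.
  + exact: measurable_band.
  + exact: measurable_pow.
  + by move=> y _; exact: poweR_ge0.
Qed.

Lemma sum_trunc_grad_le (u g : X -> \bar R) (l k' : nat -> R) : admissible u g ->
  trivIset setT (fun j => [set y | ((l j)%:E < u y < (k' j)%:E)%E]) ->
  \sum_(j <oo) I (trunc_grad u g (l j) (k' j)) B2 <= (G g)%:E.
Proof.
move=> adm tS; have [iu g0 mg Ioo _] := adm.
have lr2 : (0 < 2 * lam * r <= r0)%R.
  by rewrite !mulr_gt0//= lr_le_r0// ler0n ler_nat.
have mu_ : measurable_fun B2 u by exact: measurable_int (iu _ _ Ex0 lr2).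
under eq_eseriesr => j _.
  under eq_integral do rewrite trunc_grad_powE//.
  rewrite -integral_mkcondr.
  over.
rewrite -ge0_integral_bigcup.
- rewrite -(GK adm); apply: ge0_subset_integral => //.
  + by apply: bigcup_measurable => j _; exact: measurable_band.
  + exact: measurable_pow.
  + by move=> y _; exact: poweR_ge0.
  + by apply: bigcup_sub => j _; exact: subIsetl.
- by move=> j; exact: measurable_band.
- apply: (measurable_funS _ _ (measurable_pow mg)) => //.
  by apply: bigcup_sub => j _; exact: subIsetl.
- by move=> y _; exact: poweR_ge0.
by move=> i j _ _ [y [[_ Si] [_ Sj]]]; apply: tS => //; exists y.
Qed.

(* Whatever the mean of the truncation, it is far from one of [a] and [b]; if it is
   far from [a], the weak type estimate controls the larger set [D1]. *)
Lemma trunc_level_measure (u g : X -> \bar R) (l k' a b y : R)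
    (D1 D2 : set (g_sigma_algebraType Gnu)) :
  admissible (trunc u l k') (trunc_grad u g l k') -> dyadic_ae (trunc u l k') ->
  measurable_fun D u -> measurable D1 -> measurable D2 -> D1 `<=` D -> D2 `<=` D ->
  (forall x, D1 x -> trunc u l k' x = a%:E) ->
  (forall x, D2 x -> trunc u l k' x = b%:E) ->
  nu D2 <= nu D1 -> (0 < y)%R -> (2 * y < `|a - b|)%R ->
  nu D2 <= ((A (trunc_grad u g l k') / y) `^ q)%:E.
Proof.
move=> adm lim mu_ mD1 mD2 D1D D2D D1a D2b D21 y0 yab.
set v := trunc u l k' in adm lim D1a D2b *.
have mv : measurable_fun D v.
  by apply: measurable_maxe => //; exact: measurable_mine.
have wk := weak_type_measure adm lim mv y0.
set S := _ `&` _ in wk.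
have mS : measurable S.
  by apply: emeasurable_fun_o_infty => //; exact: measurable_dist.
have [yb|yb] := ltP y `|b - U v x0 r|%R.
  apply: le_trans wk; apply: le_measure; rewrite ?inE// => x D2x.
  by split; [exact: D2D|rewrite /= D2b].
apply: le_trans D21 _; apply: le_trans wk; apply: le_measure; rewrite ?inE// => x D1x.
split; first exact: D1D.
rewrite /= D1a// lte_fin; have := ler_distD (U v x0 r) a b.
by rewrite [(`|U v x0 r - b|)%R]distrC; lra.
Qed.

Lemma trunc_above (u : X -> \bar R) (l k' : R) (x : X) : (l < k')%R ->
  k'%:E <= u x -> trunc u l k' x = k'%:E.
Proof.
move=> lk ku; rewrite /trunc (min_idPr ku); apply/max_idPr.
by rewrite lee_fin ltW.
Qed.

Lemma trunc_below (u : X -> \bar R) (l k' : R) (x : X) : (l < k')%R ->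
  u x <= l%:E -> trunc u l k' x = l%:E.
Proof.
move=> lk ul; have uk : u x <= k'%:E by rewrite (le_trans ul)// lee_fin ltW.
by rewrite /trunc (min_idPl uk); apply/max_idPl.
Qed.

Lemma dyadic_ae_trunc (u g : X -> \bar R) (l k' : R) : admissible u g ->
  dyadic_ae u -> dyadic_ae (trunc u l k').
Proof.
move=> adm [N [mN N0 Nlim]]; have [M' [mM' M0 Mlim]] := maximal_le_ae adm.
exists (N `|` M'); split; first exact: measurableU.
  apply/eqP; rewrite eq_le measure_ge0 andbT.
  apply: (@le_trans _ _ (nu N + nu M')); first exact: measureU2.
  by rewrite N0 M0 adde0.
move=> x Ex xx0 /not_orP[nNx nMx]; have [s [s0 sx]] := Mlim _ Ex xx0 nMx.
exact: (dyadic_limit_trunc adm Ex xx0 s0 sx (Nlim _ Ex xx0 nNx)).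
Qed.

(** The outer 2 comes from the levels starting at 2T and growing by factors 2, the inner 2 from T^q
    nu(D) = 2 A'^q, and 2 8^q from the two sides of the mean, each tested at one eighth of its
    level. *)
Definition strong_cst : R := (2 * (2 + 2 * 8 `^ q) `^ q^-1)%R.

Lemma strong_cst_gt0 : (0 < strong_cst)%R.
Proof. by rewrite mulr_gt0// powR_gt0// addr_gt0// mulr_gt0// powR_gt0. Qed.

(** Each G(h j) is at most Gg, so G(h j)^(q/p) <= Gg^(q/p - 1) G(h j) because q/p >= 1; the terms on
    the right add up to at most Gg^(q/p). *)
Let sum_bound (h : nat -> X -> \bar R) (Gg : R) : (0 <= Gg)%R ->
  (forall j, I (h j) B2 \is a fin_num) ->
  \sum_(j <oo) I (h j) B2 <= Gg%:E ->
  \sum_(j <oo) (G (h j) `^ (q / p))%:E <= (Gg `^ (q / p))%:E.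
Proof.
move=> Gg0 hfin hsum.
have I0 j : 0 <= I (h j) B2 by apply: integral_ge0 => y _; exact: poweR_ge0.
have GE j : (G (h j))%:E = I (h j) B2 by rewrite fineK.
have Gle j : (G (h j) <= Gg)%R.
  rewrite -lee_fin GE (le_trans _ hsum)//.
  apply: le_trans (nneseries_lim_ge j.+1 _) => //.
  by rewrite big_nat_recr//= leeDr// sume_ge0.
have qp : (0 < q / p)%R by rewrite divr_gt0.
rewrite -(mulr_powRB1 Gg0 qp) [(Gg * _)%R]mulrC EFinM.
apply: (@le_trans _ _ ((Gg `^ (q / p - 1))%:E * \sum_(j <oo) I (h j) B2)); last first.
  by rewrite lee_wpmul2l// lee_fin powR_ge0.
rewrite -nneseriesZl//; apply: lee_nneseries => [j _ _|j _].
  by rewrite lee_fin powR_ge0.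
rewrite -GE -EFinM lee_fin -(mulr_powRB1 (G_ge0 _) qp) [leLHS]mulrC ler_wpM2r//.
by apply: ler_powR2l => //; rewrite subr_ge0 ler_pdivlMr// mul1r ltW.
Qed.

Let poincare_eq_aux (u g : X -> \bar R) (A' : R) : admissible u g -> dyadic_ae u ->
  measurable_fun D u ->
  (forall l k', (l < k')%R ->
    Poincare mu E r0 alpha p lam CP (trunc u l k') (trunc_grad u g l k')) ->
  (0 < fine (nu D))%R -> (0 < A')%R -> (A g <= A')%R ->
  \int[nu]_(y in D) (`|u y - (U u x0 r)%:E| `^ q) <= ((strong_cst * A') `^ q)%:E.
Proof.
move=> adm ulim mu_ PT N0 A'0 AA'.
set c := U u x0 r; set N := fine (nu D) in N0.
have DN : nu D = N%:E by rewrite fineK.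
pose f y := `|u y - c%:E|.
have mf : measurable_fun D f by exact: measurable_dist.
have f0 y : 0 <= f y by exact: abse_ge0.
(* Chosen so that the weak type bound at T is half of nu(D): then [D1] has at least half the measure
   and each set beyond T at most half, as [trunc_level_measure] demands. *)
pose T := (A' * (2 / N) `^ q^-1)%R.
have T0 : (0 < T)%R by rewrite mulr_gt0// powR_gt0// divr_gt0.
have Tq : (T `^ q * N = 2 * A' `^ q)%R.
  rewrite /T powRM ?powR_ge0 ?(ltW A'0)// -powRrM mulVf ?gt_eqF// powRr1; last first.
    by rewrite divr_ge0// ltW.
  by field; rewrite gt_eqF.
have A'T : ((A' / T) `^ q = N / 2)%R.
  have : ((A' / T) `^ q * (T `^ q * N) = A' `^ q * N)%R.
    rewrite mulrA -powRM ?divr_ge0 ?(ltW A'0) ?(ltW T0)// divfK// gt_eqF//.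
  rewrite Tq => H; have Aq : (0 < A' `^ q)%R by rewrite powR_gt0.
  apply: (mulfI (x := (2 * A' `^ q)%R)); first by rewrite gt_eqF// mulr_gt0.
  by rewrite mulrC H; field.
clearbody T.
pose S0 : set (g_sigma_algebraType Gnu) := D `&` [set y | T%:E < f y].
pose D1 : set (g_sigma_algebraType Gnu) := D `&` [set y | f y <= T%:E].
have mS0 : measurable S0 by exact: emeasurable_fun_o_infty.
have mD1 : measurable D1 by exact: emeasurable_fun_infty_c.
have nuS0 : nu S0 <= (N / 2)%:E.
  apply: le_trans (weak_type_measure adm ulim mu_ T0) _; rewrite -A'T lee_fin.
  by rewrite ler_powR2l ?divr_ge0 ?(ltW q0) ?(ltW T0)// ler_pM2r// invr_gt0.
have nuD1 : (N / 2)%:E <= nu D1.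
  have : nu D <= nu S0 + nu D1.
    apply: (@le_trans _ _ (nu (S0 `|` D1))); last exact: measureU2.
    apply: le_measure; rewrite ?inE//; first exact: measurableU.
    by move=> y Dy; have [?|?] := leP (f y) T%:E; [right|left].
  rewrite DN => /le_trans/(_ (leeD2r _ nuS0)).
  case: (nu D1) (measure_ge0 nu D1) => [d _| |]; rewrite ?leey// lee_fin => d1.
  by rewrite lee_fin; lra.
have D1bound y : D1 y -> ((c - T)%:E <= u y) /\ (u y <= (c + T)%:E).
  move=> [_ /=]; rewrite /f; case: (u y) => [z| |]//; rewrite !lee_fin.
  by rewrite ler_norml => /andP[? ?]; split; lra.
have tn (n : nat) : (0 < 2 ^+ n * T)%R by rewrite mulr_gt0// exprn_gt0.
have tT (n : nat) : (T <= 2 ^+ n * T)%R.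
  by rewrite ler_peMl ?(ltW T0)// exprn_ege1// ler1n.
have t2 (n : nat) : (2 ^+ n * (2 * T) = 2 * (2 ^+ n * T))%R by ring.
(* One truncation per dyadic band above the mean and one per band below: it has the value of the
   near end on [D1] and that of the far end where [u] is beyond the band. *)
pose hp n := trunc_grad u g (c + 2 ^+ n * T) (c + 2 ^+ n * (2 * T)).
pose hm n := trunc_grad u g (c - 2 ^+ n * (2 * T)) (c - 2 ^+ n * T).
have lkp n : (c + 2 ^+ n * T < c + 2 ^+ n * (2 * T))%R.
  by have := tn n; rewrite t2; lra.
have lkm n : (c - 2 ^+ n * (2 * T) < c - 2 ^+ n * T)%R.
  by have := tn n; rewrite t2; lra.
have admp n := admissible_trunc adm (PT _ _ (lkp n)).
have admm n := admissible_trunc adm (PT _ _ (lkm n)).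
have wt0 : (0 <= weak_cst * theta)%R by rewrite mulr_ge0// ltW// weak_cst_gt0.
(* The ends of a band differ by 2^n T and the test height must be less than half of that. The height
   2^n T / 4 is one eighth of the level 2^n (2T), whence the 8. *)
have yE (n : nat) (h : X -> \bar R) : ((A h / (2 ^+ n * T / 4)) `^ q =
    (8 * (weak_cst * theta)) `^ q * G h `^ (q / p) / (2 ^+ n * (2 * T)) `^ q)%R.
  have t4 : (0 < 2 ^+ n * (2 * T))%R by rewrite t2 mulr_gt0.
  rewrite [(A h / _)%R](_ : _ = 8 * (weak_cst * theta) * G h `^ p^-1 *
      (2 ^+ n * (2 * T))^-1)%R; last first.
    by rewrite /A t2; field; rewrite (gt_eqF T0)/= expf_neq0.
  move: (weak_cst * theta)%R wt0 => w w0.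
  rewrite powRM ?mulr_ge0 ?powR_ge0 ?invr_ge0 ?(ltW t4)//.
  rewrite powRM ?mulr_ge0 ?powR_ge0//.
  by rewrite -powRrM [(p^-1 * q)%R]mulrC -(powR_inv1 (ltW t4)) -powRrM mulN1r powRN.
have D2bound (D2 : set (g_sigma_algebraType Gnu)) : measurable D2 ->
    D2 `<=` S0 -> nu D2 <= nu D1.
  move=> mD2 D2S; apply: le_trans nuD1; apply: le_trans nuS0.
  by apply: le_measure; rewrite ?inE.
have yn0 n : (0 < 2 ^+ n * T / 4)%R by rewrite divr_gt0.
have measp n : nu (D `&` [set y | (c + 2 ^+ n * (2 * T))%:E < u y]) <=
    ((8 * (weak_cst * theta)) `^ q * G (hp n) `^ (q / p) / (2 ^+ n * (2 * T)) `^ q)%:E.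
  rewrite -yE; set D2 := _ `&` _.
  have mD2 : measurable D2 by exact: emeasurable_fun_o_infty.
  apply: (trunc_level_measure (D1 := D1) (D2 := D2) (a := (c + 2 ^+ n * T)%R)
    (b := (c + 2 ^+ n * (2 * T))%R) (admp n) (dyadic_ae_trunc _ _ adm ulim)) => //.
  - by move=> y [].
  - by move=> y [].
  - move=> y D1y; apply: trunc_below => //.
    have [_ uy] := D1bound y D1y; rewrite (le_trans uy)// lee_fin.
    by have := tT n; lra.
  - by move=> y [_ /ltW]; exact: trunc_above.
  - apply: D2bound => // y [Dy /= uy]; split => //=; rewrite /f.
    move: uy; case: (u y) => [z| |]//; rewrite ?ltry// !lte_fin => uy.
    rewrite (lt_le_trans _ (ler_norm _))//.
    by have := tT n; have := tn n; move: uy; rewrite t2; lra.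
  - by rewrite distrC t2 ger0_norm; have := tn n; lra.
have measm n : nu (D `&` [set y | u y < (c - 2 ^+ n * (2 * T))%:E]) <=
    ((8 * (weak_cst * theta)) `^ q * G (hm n) `^ (q / p) / (2 ^+ n * (2 * T)) `^ q)%:E.
  rewrite -yE; set D2 := _ `&` _.
  have mD2 : measurable D2 by exact: emeasurable_fun_infty_o.
  apply: (trunc_level_measure (D1 := D1) (D2 := D2) (a := (c - 2 ^+ n * T)%R)
    (b := (c - 2 ^+ n * (2 * T))%R) (admm n) (dyadic_ae_trunc _ _ adm ulim)) => //.
  - by move=> y [].
  - by move=> y [].
  - move=> y D1y; apply: trunc_above => //.
    have [uy _] := D1bound y D1y; rewrite (le_trans _ uy)// lee_fin.
    by have := tT n; lra.
  - by move=> y [_ /ltW]; exact: trunc_below.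
  - apply: D2bound => // y [Dy /= uy]; split => //=; rewrite /f.
    move: uy; case: (u y) => [z| |]//; rewrite ?ltry// !lte_fin => uy.
    rewrite distrC (lt_le_trans _ (ler_norm _))//.
    by have := tT n; have := tn n; move: uy; rewrite t2; lra.
  - by rewrite t2 ger0_norm; have := tn n; lra.
pose cn n := ((8 * (weak_cst * theta)) `^ q *
  (G (hp n) `^ (q / p) + G (hm n) `^ (q / p)))%R.
have meas n : nu (D `&` [set y | (2 ^+ n * (2 * T))%:E < f y]) <=
    (cn n / (2 ^+ n * (2 * T)) `^ q)%:E.
  rewrite /cn mulrDr mulrDl EFinD.
  apply: le_trans (leeD (measp n) (measm n)).
  have mp : measurable (D `&` [set y | (c + 2 ^+ n * (2 * T))%:E < u y]).
    exact: emeasurable_fun_o_infty.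
  have mm : measurable (D `&` [set y | u y < (c - 2 ^+ n * (2 * T))%:E]).
    exact: emeasurable_fun_infty_o.
  apply: le_trans (measureU2 _ mp mm); apply: le_measure; rewrite ?inE.
  - exact: emeasurable_fun_o_infty.
  - exact: measurableU.
  move=> y [Dy /=]; rewrite /f; case uy : (u y) => [z| |] fy.
  - move: fy; rewrite lte_fin ltr_normr => /orP[H|H]; [left|right];
      by split; rewrite //= ?uy lte_fin; lra.
  - by left; split; rewrite //= ?uy ltry.
  - by right; split; rewrite //= ?uy ltNyr.
have T2 : (0 < 2 * T)%R by rewrite mulr_gt0.
apply: le_trans (integral_poweR_le_dyadic_sum mD mf (fun y _ => f0 y) T2 q0 meas) _.
have Ge : (A g `^ q = (weak_cst * theta) `^ q * G g `^ (q / p))%R.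
  by rewrite /A powRM ?powR_ge0// -powRrM [(p^-1 * q)%R]mulrC.
(* A band ends where the next one begins, and the inequalities defining the bands are strict; so the
   bands are disjoint. *)
have mono (m n : nat) : (m < n)%N -> (2 ^+ m * (2 * T) <= 2 ^+ n * T)%R.
  move=> mn; rewrite mulrA -exprSr ler_pM2r//.
  by rewrite ler_eXn2l ?ltr1n.
have sump : \sum_(n <oo) (G (hp n) `^ (q / p))%:E <= (G g `^ (q / p))%:E.
  apply: sum_bound => // [n|]; first by rewrite (GK (admp n)).
  apply: sum_trunc_grad_le => //; apply: ltn_trivIset => m n mn.
  apply/seteqP; split => // y [/= /andP[_ yk] /andP[ly _]].
  have := lt_trans ly yk; rewrite lte_fin ltNge => /negP; apply.
  by rewrite lerD2l mono.
have summ : \sum_(n <oo) (G (hm n) `^ (q / p))%:E <= (G g `^ (q / p))%:E.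
  apply: sum_bound => // [n|]; first by rewrite (GK (admm n)).
  apply: sum_trunc_grad_le => //; apply: ltn_trivIset => m n mn.
  apply/seteqP; split => // y [/= /andP[ly _] /andP[_ yk]].
  have := lt_trans ly yk; rewrite lte_fin ltNge => /negP; apply.
  by rewrite lerD2l lerN2 mono.
have sumc : \sum_(n <oo) (cn n)%:E <= (2 * 8 `^ q * A g `^ q)%:E.
  under eq_eseriesr do rewrite EFinM EFinD.
  rewrite nneseriesZl; last by move=> n _; rewrite adde_ge0 ?lee_fin ?powR_ge0.
  rewrite nneseriesD; last 2 first.
  - by move=> n _ _; rewrite lee_fin powR_ge0.
  - by move=> n _ _; rewrite lee_fin powR_ge0.
  apply: (@le_trans _ _ (((8 * (weak_cst * theta)) `^ q)%:E *
      ((G g `^ (q / p))%:E + (G g `^ (q / p))%:E))).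
    by apply: lee_wpmul2l; [rewrite lee_fin powR_ge0|exact: leeD sump summ].
  rewrite -EFinD -EFinM lee_fin Ge powRM//.
  by rewrite le_eqVlt; apply/orP; left; apply/eqP; ring.
apply: (@le_trans _ _ (((2 * T) `^ q)%:E * nu D +
    (2 `^ q)%:E * (2 * 8 `^ q * A g `^ q)%:E)).
  by rewrite leeD2l// lee_wpmul2l// lee_fin powR_ge0.
rewrite DN -!EFinM -EFinD lee_fin /strong_cst.
rewrite [((2 * T) `^ q)%R]powRM ?(ltW T0)// -[(_ * _ * N)%R]mulrA Tq -mulrDr.
have K8 : (0 <= 2 + 2 * 8 `^ q :> R)%R by rewrite addr_ge0// mulr_ge0// powR_ge0.
rewrite powRM ?mulr_ge0 ?powR_ge0 ?(ltW A'0)// powRM ?powR_ge0//.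
rewrite -powRrM mulVf ?gt_eqF// powRr1// -[leRHS]mulrA ler_wpM2l ?powR_ge0//.
rewrite [leRHS]mulrDl lerD2l ler_wpM2l ?mulr_ge0 ?powR_ge0//.
by rewrite ler_powR2l// ltW.
Qed.

Lemma poincare_eq (u g : X -> \bar R) : admissible u g -> dyadic_ae u ->
  measurable_fun D u ->
  (forall l k', (l < k')%R ->
    Poincare mu E r0 alpha p lam CP (trunc u l k') (trunc_grad u g l k')) ->
  (\int[nu]_(y in D) (`|u y - mean mu (ball x0 r) u| `^ q)) `^ q^-1 <=
  (strong_cst * A g)%:E.
Proof.
move=> adm ulim mu_ PT; have S0 := strong_cst_gt0.
have [D0|D0] := eqVneq (nu D) 0.
  rewrite null_oscillation// poweR0r ?invr_neq0 ?gt_eqF//.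
  by rewrite lee_fin mulr_ge0// ltW.
have N0 : (0 < fine (nu D))%R.
  by rewrite fine_gt0// lt0e D0 measure_ge0/= ltey_eq D_fin.
apply/lee_addgt0Pr => e e0; rewrite -EFinD.
(* [A g] may be 0, while the height T in the auxiliary estimate must be positive; the increment adds
   exactly e to the final bound. *)
pose A' := (A g + e / strong_cst)%R.
have A'0 : (0 < A')%R by rewrite ltr_wpDl// divr_gt0.
have AA' : (A g <= A')%R by rewrite lerDl divr_ge0// ltW.
rewrite (meanE adm).
have SA : (0 <= strong_cst * A')%R by rewrite mulr_ge0// ltW.
have qV0 : (0 <= q^-1)%R by rewrite invr_ge0 ltW.
have intle := poincare_eq_aux adm ulim mu_ PT N0 A'0 AA'.
apply: le_trans (gt0_ler_poweR qV0 _ _ intle) _.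
- by rewrite in_itv/= leey andbT integral_ge0// => y _; exact: poweR_ge0.
- by rewrite in_itv/= leey andbT lee_fin powR_ge0.
rewrite poweR_EFin -powRrM mulfV ?gt_eqF// powRr1// lee_fin /A' mulrDr.
by rewrite [(strong_cst * (e / _))%R]mulrCA mulfV ?gt_eqF// mulr1.
Qed.

End chaining.

(** * The theorem *)

Section conclusion.
Context {R : realType} {X : pmetricType R} {Gmu Gnu : set (set X)}.
Variables (mu : {measure set (g_sigma_algebraType Gmu) -> \bar R})
  (nu : {measure set (g_sigma_algebraType Gnu) -> \bar R}).
Implicit Types (E : set X).

(** A point of [E] keeps the supremum from being -oo, and monotonicity in the radius makes it
    finite. The denominators are positive and finite, so the defining ratio can be cleared into the
    product form used by the chain. *)
Lemma Theta_fine E (r0 C p q alpha lam r : R) :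
  complete_Borel mu -> (0 < C)%R -> doubling_on mu E r0 C -> doubling_on nu E r0 C ->
  (0 < r)%R -> (1 <= lam)%R -> (lam * r <= r0)%R -> E !=set0 ->
  Theta mu nu E alpha p q lam r0 < +oo ->
  let theta := fine (Theta mu nu E alpha p q lam r) in
  [/\ Theta mu nu E alpha p q lam r = theta%:E, (0 <= theta)%R &
    forall x rho, E x -> (0 < rho <= r)%R ->
    (rho `^ alpha * fine (nu (ball x rho)) `^ q^-1 <=
     theta * fine (mu (ball x (lam * rho))) `^ p^-1)%R].
Proof.
move=> bmu C0 dmu dnu r_gt0 lam1 lr [x1 Ex1] Too theta.
have lam0 : (0 < lam)%R := lt_le_trans ltr01 lam1.
have rr0 : (r <= r0)%R by rewrite (le_trans _ lr)// ler_peMl// ltW.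
have term_le x rho : E x -> (0 < rho <= r)%R ->
    (rho `^ alpha)%:E * nu (ball x rho) `^ q^-1 / mu (ball x (lam * rho)) `^ p^-1 <=
    Theta mu nu E alpha p q lam r.
  move=> Ex rhor; apply: le_ereal_sup_tmp.
  exists (ereal_sup [set (rho `^ alpha)%:E * nu (ball y rho) `^ q^-1
     / mu (ball y (lam * rho)) `^ p^-1 | y in E]); first by exists rho.
  by apply: ereal_sup_ubound; exists x.
have Tge0 : 0 <= Theta mu nu E alpha p q lam r.
  have rr : (0 < r <= r)%R by rewrite r_gt0 lexx.
  apply: le_trans (term_le _ _ Ex1 rr).
  by rewrite !mule_ge0 ?poweR_ge0 ?inve_ge0 ?poweR_ge0// lee_fin powR_ge0.
have Tle : Theta mu nu E alpha p q lam r <= Theta mu nu E alpha p q lam r0.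
  apply: ereal_sup_le => _ [rho /= /andP[rho0 rhor] <-].
  by exists rho => //=; rewrite rho0 (le_trans rhor).
have Tfin : Theta mu nu E alpha p q lam r \is a fin_num.
  by rewrite ge0_fin_numE// (le_lt_trans Tle).
split; [by rewrite fineK|exact: fine_ge0|].
move=> x rho Ex /andP[rho0 rhor].
have := term_le _ _ Ex (introT andP (conj rho0 rhor)).
have lrho : (0 < lam * rho <= r0)%R.
  by rewrite mulr_gt0//= (le_trans _ lr)// ler_pM2l.
have rhor0 : (0 < rho <= r0)%R by rewrite rho0 (le_trans rhor).
have m0 := mu_ball_fine_gt0 C0 dmu Ex lrho.
rewrite -(fineK Tfin) -/theta -(fineK (mu_ball_fin C0 dnu Ex rhor0)).
rewrite -(fineK (mu_ball_fin C0 dmu Ex lrho)) !poweR_EFin inver.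
by rewrite gt_eqF ?powR_gt0// -!EFinM lee_fin ler_pdivrMr// powR_gt0.
Qed.

Lemma Lploc_admissible E (r0 p alpha lam CP : R) (x0 : X) (r : R) (u g : X -> \bar R) :
  complete_Borel mu -> (1 <= lam)%R -> (0 < r)%R ->
  Lploc mu 1 u -> (forall x, 0 <= g x) -> Lploc mu p g ->
  Poincare mu E r0 alpha p lam CP u g ->
  admissible mu E r0 p alpha lam CP x0 r u g.
Proof.
move=> bmu lam1 r_gt0 locu g0 locg PI.
have r2 : (0 < 2 * lam * r)%R by rewrite !mulr_gt0// (lt_le_trans ltr01).
have [mg gp] := locg x0 _ r2.
split => //.
- move=> x rho Ex /andP[rho0 _]; have [mu_ up] := locu x rho rho0.
  apply/integrableP; split => //.
  by move: up; under eq_integral do rewrite poweRe1//.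
- by under eq_integral do rewrite -(gee0_abs (g0 _)).
Qed.

Lemma Lebesgue_values_dyadic_ae E (x0 : X) (r : R) (u : X -> \bar R) : (0 < r)%R ->
  {ae nu, forall x, E x -> Lebesgue_values mu u x} -> dyadic_ae mu nu E x0 r u.
Proof.
move=> r0 [N [mN N0 NP]]; exists N; split => // x Ex _ nNx.
apply: Lebesgue_values_dyadic => //; apply: contrapT => nL.
by apply: nNx; apply: NP => /= /(_ Ex).
Qed.

(** By induction on the list of balls: the part of [A] in the first ball has finite integral by
    assumption, and the rest is covered by the remaining balls. *)
Lemma integral_finite_union_lty (w : X -> \bar R) (rho : R) (A E : set X) (s : seq X) :
  (forall y, measurable (ball y rho `&` E : set (g_sigma_algebraType Gnu))) ->
  measurable (A : set (g_sigma_algebraType Gnu)) -> A `<=` E ->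
  measurable (E : set (g_sigma_algebraType Gnu)) ->
  measurable_fun (E : set (g_sigma_algebraType Gnu)) w -> (forall x, 0 <= w x) ->
  (forall y, y \in s -> \int[nu]_(x in ball y rho `&` E) w x < +oo) ->
  A `<=` \bigcup_(y in [set` s]) ball y rho ->
  \int[nu]_(x in A) w x < +oo.
Proof.
move=> mb mA AE mE mw w0; elim: s A mA AE => [|y s ih] A mA AE ws As.
  rewrite (_ : A = set0) ?integral_set0//.
  by apply/seteqP; split => // x /As[].
have mAy : measurable (A `&` (ball y rho `&` E) : set (g_sigma_algebraType Gnu)).
  exact: measurableI.
have mAD : measurable (A `\` (ball y rho `&` E) : set (g_sigma_algebraType Gnu)).
  exact: measurableD.
have AU : A = (A `&` (ball y rho `&` E)) `|` (A `\` (ball y rho `&` E)).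
  by rewrite setUIDK.
rewrite AU ge0_integral_setU//; last 2 first.
- by rewrite -AU; exact: measurable_funS mw.
- by apply/disj_setPS => z [[_ +] [_]].
apply: lte_add_pinfty.
  apply: le_lt_trans (ws y (mem_head _ _)).
  apply: ge0_subset_integral; [exact: mAy|exact: mb| |by []|exact: subIsetr].
  by apply: (measurable_funS mE _ mw); exact: subIsetr.
apply: ih => //; first by apply: subset_trans AE; exact: subDsetl.
  by move=> z zs; apply: ws; rewrite in_cons zs orbT.
move=> x [Ax nx]; have [z /= + zx] := As x Ax.
rewrite inE => /orP[/eqP zy|zs]; last by exists z.
by exfalso; apply: nx; split; [rewrite -zy|exact: AE].
Qed.

End conclusion.

(** |z| is at most twice the larger of |z - c| and |c|, which needs no convexity of the power; for
    infinite [a] both sides are infinite. *)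
Lemma poweR_abs_le {R : realType} (a : \bar R) (c e : R) : (0 < e)%R ->
  `|a| `^ e <= (2 `^ e)%:E * (`|a - c%:E| `^ e + (`|c| `^ e)%:E).
Proof.
move=> e0; have p2 : (0 < 2 `^ e :> R)%R by rewrite powR_gt0.
have oo : +oo `^ e <= (2 `^ e)%:E * (+oo `^ e + (`|c| `^ e)%:E).
  by rewrite poweRyr ?gt_eqF// addye// gt0_muley ?lte_fin.
case: a => [z| |]; [|exact: oo|exact: oo].
rewrite /= -EFinD -EFinM lee_fin.
have zc : (`|z| <= `|z - c| + `|c|)%R by rewrite -[in leLHS](subrK c z) ler_normD.
have [h|h] := leP `|z - c|%R `|c|%R.
- apply: (@le_trans _ _ ((2 * `|c|) `^ e)%R).
    by rewrite ler_powR2l ?(ltW e0)//; lra.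
  by rewrite powRM// ler_wpM2l ?(ltW p2)// lerDr powR_ge0.
- apply: (@le_trans _ _ ((2 * `|z - c|) `^ e)%R).
    by rewrite ler_powR2l ?(ltW e0)//; lra.
  by rewrite powRM// ler_wpM2l ?(ltW p2)// lerDl powR_ge0.
Qed.

Theorem theorem4p1 (R : realType) (X : pmetricType R) (Gmu Gnu : set (set X))
    (mu : {measure set (g_sigma_algebraType Gmu) -> \bar R})
    (nu : {measure set (g_sigma_algebraType Gnu) -> \bar R})
    (p q alpha lam delta CD CP : R)
    (mu_Borel : complete_Borel mu) (nu_Borel : complete_Borel nu)
    (p_ge1 : (1 <= p)%R) (p_lt_q : (p < q)%R) (alpha_gt0 : (0 < alpha)%R)
    (lam_ge1 : (1 <= lam)%R) (delta_gt0 : (0 < delta)%R)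
    (CD_gt0 : (0 < CD)%R) (CP_gt0 : (0 < CP)%R) :
  exists2 Cql : R, (0 < Cql)%R &
  forall (E : set X) (r0 : R) (u g : X -> \bar R),
    measurable (E : set (g_sigma_algebraType Gnu)) -> 0 < nu E ->
    (0 < r0)%R ->
    doubling_on mu E r0 CD -> doubling_on nu E r0 CD ->
    reverse_doubling_on nu E r0 CD delta ->
    Lploc mu 1 u ->
    {ae nu, forall x, E x -> Lebesgue_values mu u x} ->
    (forall x, 0 <= g x) -> Lploc mu p g ->
    Poincare mu E r0 alpha p lam CP u g ->
    Theta mu nu E alpha p q lam r0 < +oo ->
    (forall q' : R, (1 <= q')%R -> (q' < q)%R ->
      (forall (x : X) (r : R), E x -> (0 < r)%R -> (10 * lam * r <= r0)%R ->
        (\int[nu]_(y in ball x r `&` E)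
            (`|u y - mean mu (ball x r) u| `^ q')) `^ q'^-1 <=
        Cql%:E * Theta mu nu E alpha p q lam r
          * (nu (ball x r `&` E) `^ (q'^-1 - q^-1) / (q - q')%:E)
          * (\int[mu]_(y in ball x (2 * lam * r)) (g y `^ p)) `^ p^-1)
      /\ Lploc_in nu q' E (r0 / (10 * lam)) u)
    /\
    (truncation_property mu E r0 alpha p lam CP u g ->
      forall (x : X) (r : R), E x -> (0 < r)%R -> (10 * lam * r <= r0)%R ->
        (\int[nu]_(y in ball x r `&` E)
            (`|u y - mean mu (ball x r) u| `^ q)) `^ q^-1 <=
        Cql%:E * Theta mu nu E alpha p q lam r
          * (\int[mu]_(y in ball x (2 * lam * r)) (g y `^ p)) `^ p^-1).
Proof.
have lam0 : (0 < lam)%R := lt_le_trans ltr01 lam_ge1.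
(* [k] depends on [lam] alone, so the constant can be fixed before [E], [r0], [u] and [g]. *)
have [k hk] : exists k, (2 ^+ k < 2 * lam <= 2 ^+ k.+1)%R.
  have [|k] := @exists_dyadic R 1 (2 * lam) ltr01.
    by rewrite (lt_le_trans (ltr1n R 2 : 1 < 2)%R)// ler_peMr.
  by rewrite !mulr1; exists k.
have q0 : (0 < q)%R by rewrite (lt_trans _ p_lt_q)// (lt_le_trans ltr01).
have [W WE W0] : exists2 W : R, W = weak_cst p q alpha delta CD CP k & (0 < W)%R.
  by eexists; [reflexivity|exact: weak_cst_gt0].
have wi0 := weak_int_cst_gt0 q0; have ws0 : (0 < strong_cst q)%R := strong_cst_gt0 q.
exists ((weak_int_cst q + strong_cst q) * W)%R; first by rewrite mulr_gt0// addr_gt0.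
move=> E r0 u g mE nuE0 r00 dmu dnu rdnu locu ulim g0 locg PI Too.
have mu_ := measurable_Lebesgue mu_Borel nu_Borel CD_gt0 r00 dmu mE locu ulim.
have lr_r0 r : (0 < r)%R -> (10 * lam * r <= r0)%R -> (lam * r <= r0)%R.
  move=> r_gt0 /(le_trans _); apply; rewrite -mulrA ler_peMl ?ler1n//.
  by rewrite mulr_ge0// ltW.
have mD x r : measurable (ball x r `&` E : set (g_sigma_algebraType Gnu)).
  by apply: measurableI => //; exact: (measurable_ball _ _ nu_Borel).
have mDu x r : measurable_fun (ball x r `&` E : set (g_sigma_algebraType Gnu)) u.
  by apply: (measurable_funS mE _ mu_); exact: subIsetr.
(* From the real-valued bounds to the stated form: B is [weak_int_cst q] or [strong_cst q], and Z is
   the factor with nu and q - q' in (i), 1 in (ii). *)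
have cmp (x : X) (r B : R) (Z : \bar R) : E x -> (0 < r)%R -> (10 * lam * r <= r0)%R ->
    0 <= Z -> (0 <= B)%R -> (B <= weak_int_cst q + strong_cst q)%R ->
    (B * (W * fine (Theta mu nu E alpha p q lam r) *
      fine (\int[mu]_(y in ball x (2 * lam * r)) (g y `^ p)) `^ p^-1))%:E * Z <=
    ((weak_int_cst q + strong_cst q) * W)%:E * Theta mu nu E alpha p q lam r * Z *
    (\int[mu]_(y in ball x (2 * lam * r)) (g y `^ p)) `^ p^-1.
  move=> Ex r_gt0 rr0 Z0 B0 BC.
  have [TE th0 _] := Theta_fine mu_Borel CD_gt0 dmu dnu r_gt0 lam_ge1
    (lr_r0 _ r_gt0 rr0) (ex_intro _ x Ex) Too.
  have [_ _ _ Goo _] :=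
    Lploc_admissible x mu_Borel lam_ge1 r_gt0 locu g0 locg PI.
  have Gf : \int[mu]_(y in ball x (2 * lam * r)) (g y `^ p) \is a fin_num.
    by rewrite ge0_fin_numE// integral_ge0// => y _; exact: poweR_ge0.
  rewrite [in leRHS]TE -[in leRHS](fineK Gf) poweR_EFin muleAC -!EFinM.
  rewrite lee_wpmul2r// lee_fin -!mulrA ler_wpM2r//.
  by apply: mulr_ge0; [exact: ltW|apply: mulr_ge0 => //; exact: powR_ge0].
have part1 q' : (1 <= q')%R -> (q' < q)%R -> forall (x : X) (r : R),
    E x -> (0 < r)%R -> (10 * lam * r <= r0)%R ->
    (\int[nu]_(y in ball x r `&` E)
        (`|u y - mean mu (ball x r) u| `^ q')) `^ q'^-1 <=
    (weak_int_cst q * (W * fine (Theta mu nu E alpha p q lam r) *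
      fine (\int[mu]_(y in ball x (2 * lam * r)) (g y `^ p)) `^ p^-1))%:E *
    (nu (ball x r `&` E) `^ (q'^-1 - q^-1) / (q - q')%:E).
  move=> q'1 q'q x r Ex r_gt0 rr0.
  have [TE th0 thP] := Theta_fine mu_Borel CD_gt0 dmu dnu r_gt0 lam_ge1
    (lr_r0 _ r_gt0 rr0) (ex_intro _ x Ex) Too.
  have adm := Lploc_admissible x mu_Borel lam_ge1 r_gt0 locu g0 locg PI.
  rewrite WE; exact: (poincare_lt mu_Borel nu_Borel p_ge1 p_lt_q alpha_gt0 lam_ge1 delta_gt0
    CD_gt0 CP_gt0 dmu dnu rdnu Ex r_gt0 rr0 th0 thP hk mE adm
    (Lebesgue_values_dyadic_ae x r_gt0 ulim) (mDu x r) q'1 q'q).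
split.
- move=> q' q'1 q'q; have s0 : (0 < q - q')%R by rewrite subr_gt0.
  have q'0 : (0 < q')%R := lt_le_trans ltr01 q'1.
  split.
    move=> x r Ex r_gt0 rr0; apply: le_trans (part1 q' q'1 q'q x r Ex r_gt0 rr0) _.
    apply: cmp => //; last by rewrite lerDl ltW.
      by rewrite mule_ge0 ?poweR_ge0// inve_ge0 lee_fin ltW.
    exact: ltW.
  move=> x r Ex r_gt0 [F [finF FE cov]]; split; first exact: mDu.
  have /finite_seqP[s Fs] := finF.
  (* The largest radius to which (i) applies. On each of the finitely many covering balls, |u|^q' is
     compared with the oscillation, finite by (i), plus a constant. *)
  pose rho := (r0 / (10 * lam))%R.
  have l10 : (0 < 10 * lam)%R by rewrite mulr_gt0.
  have rho0 : (0 < rho)%R by rewrite divr_gt0.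
  have rhor0 : (10 * lam * rho <= r0)%R by rewrite mulrC divfK ?gt_eqF.
  have mpow : measurable_fun (E : set (g_sigma_algebraType Gnu)) (fun y => `|u y| `^ q').
    by apply: (measurableT_comp (measurable_poweR _)); exact: measurableT_comp.
  have ball_lty y : E y -> \int[nu]_(z in ball y rho `&` E) (`|u z| `^ q') < +oo.
    move=> Ey.
    have mean_fin : mean mu (ball y rho) u \is a fin_num.
      apply: mean_fin_num; first exact: (measurable_ball _ _ mu_Borel).
        apply: (mu_ball_gt0 dmu) => //; rewrite rho0/= (le_trans _ (lr_r0 _ rho0 rhor0))//.
        by rewrite ler_peMl// ltW.
      have [iu _ _ _ _] :=
        Lploc_admissible y mu_Borel lam_ge1 rho0 locu g0 locg PI.
      apply: iu => //; rewrite rho0/= (le_trans _ (lr_r0 _ rho0 rhor0))//.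
      by rewrite ler_peMl// ltW.
    have nuD : nu (ball y rho `&` E) \is a fin_num.
      have rr : (0 < rho <= r0)%R.
        rewrite rho0/= (le_trans _ (lr_r0 _ rho0 rhor0))//.
        by rewrite ler_peMl// ltW.
      rewrite ge0_fin_numE//; apply: (@le_lt_trans _ _ (nu (ball y rho))).
        apply: le_measure; rewrite ?inE; [exact: mD| |exact: subIsetl].
        exact: (measurable_ball _ _ nu_Borel).
      by rewrite ltey_eq (mu_ball_fin CD_gt0 dnu Ey rr).
    have osc_fin : \int[nu]_(z in ball y rho `&` E)
        (`|u z - mean mu (ball y rho) u| `^ q') < +oo.
      apply: (@lty_poweRy _ _ q'^-1); first by rewrite invr_neq0// gt_eqF.
      apply: le_lt_trans (part1 q' q'1 q'q y rho Ey rho0 rhor0) _.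
      rewrite ltey_eq; apply/orP; left; rewrite !fin_numM ?fin_num_poweR//.
      by rewrite inver gt_eqF.
    have mosc : measurable_fun (ball y rho `&` E : set (g_sigma_algebraType Gnu))
        (fun z => `|u z - (fine (mean mu (ball y rho) u))%:E| `^ q').
      by apply: (measurableT_comp (measurable_poweR _)); exact: measurable_dist.
    apply: (@le_lt_trans _ _ (\int[nu]_(z in ball y rho `&` E) ((2 `^ q')%:E *
      (`|u z - (fine (mean mu (ball y rho) u))%:E| `^ q' +
       (`|fine (mean mu (ball y rho) u)| `^ q')%:E)))).
      apply: ge0_le_integral => //.
      - by move=> z _; exact: poweR_ge0.
      - by apply: (measurable_funS mE _ mpow); exact: subIsetr.
      - by apply: emeasurable_funM => //; exact: emeasurable_funD.
      - by move=> z _; exact: poweR_abs_le.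
    have c0 (z : X) : 0 <= (`|fine (mean mu (ball y rho) u)| `^ q')%:E.
      by rewrite lee_fin powR_ge0.
    rewrite ge0_integralZl//; last 2 first.
    - exact: emeasurable_funD.
    - by move=> z _; rewrite adde_ge0 ?poweR_ge0.
    apply: lte_mul_pinfty => //.
    rewrite ge0_integralD//; last by move=> z _; exact: poweR_ge0.
    rewrite (fineK mean_fin) integral_cst//; apply: lte_add_pinfty => //.
    by apply: lte_mul_pinfty => //; rewrite ltey_eq nuD.
  have pow_ge0 (z : X) : 0 <= `|u z| `^ q' by exact: poweR_ge0.
  have subE : ball x r `&` E `<=` E by exact: subIsetr.
  rewrite Fs in cov; apply: (integral_finite_union_lty (nu := nu) (mD ^~ rho)
    (mD x r) subE mE mpow pow_ge0 _ cov) => y ys.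
  by apply: ball_lty; apply: FE; rewrite Fs.
move=> PT x r Ex r_gt0 rr0.
have [TE th0 thP] := Theta_fine mu_Borel CD_gt0 dmu dnu r_gt0 lam_ge1
  (lr_r0 _ r_gt0 rr0) (ex_intro _ x Ex) Too.
have adm := Lploc_admissible x mu_Borel lam_ge1 r_gt0 locu g0 locg PI.
have := poincare_eq mu_Borel nu_Borel p_ge1 p_lt_q alpha_gt0 lam_ge1 delta_gt0
    CD_gt0 CP_gt0 dmu dnu rdnu Ex r_gt0 rr0 th0 thP hk mE adm
    (Lebesgue_values_dyadic_ae x r_gt0 ulim) (mDu x r) PT.
rewrite -WE => /le_trans; apply.
have := cmp x r (strong_cst q) 1 Ex r_gt0 rr0 lee01 (ltW ws0).
by rewrite !mule1; apply; rewrite lerDr ltW.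
Qed.
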